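(* Let $K$ be an algebraically closed field of characteristic zero, let $\iota\in K$ be a primitive fourth root of unity, and let $\zeta\in K$ be a (not necessarily primitive) fourth root of unity, i.e. $\zeta^4=1$. Let $A$ be either the algebra $A^{\mathrm{I}}$ or the algebra $A^{\mathrm{II}}$ defined in the context, endowed with the action, coaction, coproduct, counit and antipode described there. Then $A$ is an eight-dimensional cocommutative cosemisimple Yetter-Drinfel'd Hopf algebra over the group ring $H=K[G]$ of the group $G=\mathbb{Z}_2\times\mathbb{Z}_2$; it is commutative for $A=A^{\mathrm{I}}$ and noncommutative for $A=A^{\mathrm{II}}$, and it is nontrivial. The core of the group-like element $\eta_1=y$ is the four-dimensional subspace $\operatorname{Span}(\omega_1,\omega_2,\omega_3,\omega_4)$. This core is trivial; it is an ordinary Hopf algebra isomorphic to $K[\mathbb{Z}_2\times\mathbb{Z}_2]$ via $g_i\mapsto\omega_i$. However, it is not completely trivial: one has $g_2.\omega_2=\omega_3\neq\omega_2$, and \[\delta(\omega_2)=\tfrac12(g_1+g_3)\otimes\omega_2+\tfrac12(g_1-g_3)\otimes\omega_3,\qquad \delta(\omega_3)=\tfrac12(g_1-g_3)\otimes\omega_2+\tfrac12(g_1+g_3)\otimes\omega_3 .\] In particular, the core of a group-like element in a finite-dimensional cocommutative cosemisimple Yetter-Drinfel'd Hopf algebra over the group ring of a finite abelian group is not always completely trivial.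
   Context: **Yetter-Drinfel'd Hopf algebras.** Let $H$ be the group ring $K[G]$ of a finite abelian group $G$. A (left-left) Yetter-Drinfel'd module is a left $H$-module and left $H$-comodule $V$ with coaction $\delta(v)=v^{(1)}\otimes v^{(2)}\in H\otimes V$ such that $\delta(h.v)=v^{(1)}\otimes h.v^{(2)}$. The quasisymmetry is $\sigma_{V,W}:V\otimes W\to W\otimes V$, $v\otimes w\mapsto v^{(1)}.w\otimes v^{(2)}$. Tensor products carry the diagonal action and codiagonal coaction; $K$ carries the trivial action and coaction. A Yetter-Drinfel'd Hopf algebra $A$ over $H$ is a Hopf algebra in the category of Yetter-Drinfel'd modules: $A$ is an algebra and a coalgebra with antipode $S_A$ (convolution inverse of $\operatorname{id}_A$), all structure maps are $H$-linear and colinear, and $\Delta_A:A\to A\hat\otimes A$ and $\varepsilon_A$ are algebra homomorphisms, where $A\hat\otimes A$ is $A\otimes A$ with product $(a\otimes b)(a'\otimes b')=a(b^{(1)}.a')\otimes b^{(2)}b'$. It is called trivial if $\sigma_{A,A}(a\otimes a')=a'\otimes a$ for all $a,a'\in A$, and completely trivial if both the action ($h.a=\varepsilon_H(h)a$) and the coaction ($\delta(a)=1_H\otimes a$) of $H$ on $A$ are trivial. An element $\eta$ is group-like if $\Delta_A(\eta)=\eta\otimes\eta$ and $\varepsilon_A(\eta)=1$. For subspaces stable under all structure maps, the words trivial and completely trivial refer to the restricted structures. **Core.** Let $K$ be algebraically closed of characteristic zero and let $A$ be a finite-dimensional cocommutative cosemisimple Yetter-Drinfel'd Hopf algebra over $K[G]$;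 then $A$ has a basis consisting of its group-like elements. For a group-like element $\eta$, choose a group-like element $\eta'$ that appears with nonzero coefficient in the expansion of $S_A(\eta)$ in the basis of group-like elements. The core of $\eta$ is $\operatorname{Span}(\omega_1,\dots,\omega_m)$, the smallest subspace of $A$ that contains $\eta\eta'$ and is spanned by group-like elements. It is known that it does not depend on the choice of $\eta'$ and that it is a subalgebra stable under $S_A$. In general the core is considered as a Yetter-Drinfel'd Hopf algebra over the group ring of the index group $G_\eta=Q_\eta^\perp/(T_\eta\cap Q_\eta^\perp)$, where $T_\eta=\{g\in G: g.\eta=\eta\}$, $Q_\eta=\{\gamma\in\hat G:\gamma(\eta^{(1)})\eta^{(2)}=\eta\}$ with $\hat G=\operatorname{Hom}(G,K^\times)$, and $Q_\eta^\perp=\{g\in G:\gamma(g)=1 \text{ for all }\gamma\in Q_\eta\}$. For $\eta=\eta_1$ in the examples below, $T_\eta$ and $Q_\eta$ consist only of the unit element, so $G_\eta=G$, and the structure on the core is the restricted one. **The two algebras.** $A^{\mathrm{I}}$ is the commutative algebra generated by commuting variables $x,y$ with relations $x^4=1$, $y^2=\frac12(1+\zeta x+x^2-\zeta x^3)$. $A^{\mathrm{II}}$ is the algebra generated by noncommuting variables $x,y$ with relations $x^4=1$, $xy=yx^3$, $y^2=\frac12(\zeta 1+x-\zeta x^2+x^3)$. **Common structure** (same formulas in both cases). Write $g_1=(0,0)$, $g_2=(1,0)$, $g_3=(0,1)$, $g_4=(1,1)$ for the elements of $G=\mathbb{Z}_2\times\mathbb{Z}_2$. $G$ acts by algebra automorphisms: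 $g_2$ acts by $\phi$ with $\phi(x)=x^3$, $\phi(y)=x^3y$; $g_3$ acts by $\phi'$ with $\phi'(x)=x$, $\phi'(y)=x^2y$; $g_4$ acts by $\phi\circ\phi'$. Let $\theta:G\times G\to K^\times$ be the symmetric bicharacter with $\theta(g_2,g_2)=\zeta^2$, $\theta(g_2,g_3)=\theta(g_3,g_2)=-1$, $\theta(g_3,g_3)=1$. The coaction is $\delta(a)=\frac14\sum_{g,g'\in G}\theta(g,g')\,g\otimes g'.a$. The coproduct is the algebra homomorphism $\Delta_A:A\to A\hat\otimes A$ with $\Delta_A(x)=\frac12(x\otimes x+x\otimes x^3+x^3\otimes x-x^3\otimes x^3)$, $\Delta_A(y)=y\otimes y$; the counit is the algebra homomorphism with $\varepsilon_A(x)=\varepsilon_A(y)=1$. Set $\omega_1=1$, $\omega_2=\frac12(1+\iota\zeta^2)x+\frac12(1-\iota\zeta^2)x^3$, $\omega_3=\frac12(1-\iota\zeta^2)x+\frac12(1+\iota\zeta^2)x^3$, $\omega_4=x^2$, $\eta_1=y$, $\eta_2=x^3y$, $\eta_3=x^2y$, $\eta_4=xy$ (a basis of group-like elements). **Antipodes.** In both cases $S_A$ is linear with $S_A(\omega_i)=\omega_i$ for all $i$. For $A^{\mathrm{I}}$: $S_A(\eta_1)=\frac12(\eta_1+\frac1\zeta\eta_2+\eta_3-\frac1\zeta\eta_4)$, $S_A(\eta_2)=\frac12(\frac1\zeta\eta_1+\eta_2-\frac1\zeta\eta_3+\eta_4)$, $S_A(\eta_3)=\frac12(\eta_1-\frac1\zeta\eta_2+\eta_3+\frac1\zeta\eta_4)$,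 $S_A(\eta_4)=\frac12(-\frac1\zeta\eta_1+\eta_2+\frac1\zeta\eta_3+\eta_4)$. For $A^{\mathrm{II}}$: $S_A(\eta_1)=\frac12(\frac1\zeta\eta_1+\eta_2-\frac1\zeta\eta_3+\eta_4)$, $S_A(\eta_2)=\frac12(\eta_1+\frac1\zeta\eta_2+\eta_3-\frac1\zeta\eta_4)$, $S_A(\eta_3)=\frac12(-\frac1\zeta\eta_1+\eta_2+\frac1\zeta\eta_3+\eta_4)$, $S_A(\eta_4)=\frac12(\eta_1-\frac1\zeta\eta_2+\eta_3+\frac1\zeta\eta_4)$. *)

(* Defs.v *)
From HB Require Import structures.
From mathcomp Require Import all_boot all_order all_algebra all_fingroup all_field.
From mathcomp Require Import boolp.

Set Implicit Arguments.
Unset Strict Implicit.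
Unset Printing Implicit Defensive.

Import GRing.Theory VectorInternalTheory.
Local Open Scope ring_scope.

(* Tensor products of finite-dimensional vector spaces.  [V \ox W] is the space
   of coefficient matrices relative to the chosen coordinates of V and W; the
   properties used to identify it with the tensor product are [tens_bilin],
   [tlift_linear], [tlift_tens] and [tlift_uniq] below. *)
Section Tensor.
Variable K : fieldType.

Definition tensor (V W : vectType K) := 'M[K]_(dim V, dim W).

Definition tens (V W : vectType K) (v : V) (w : W) : tensor V W :=
  (v2r v)^T *m v2r w.

(* linear extension of a bilinear map *)
Definition tlift (V W U : vectType K) (f : V -> W -> U) (t : tensor V W) : U :=
  \sum_i \sum_j t i j *: f (r2v (delta_mx 0 i)) (r2v (delta_mx 0 j)).

Definition bilin (V W U : vectType K) (f : V -> W -> U) : Prop :=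
  (forall v, linear (f v)) /\ (forall w, linear (f^~ w)).

Lemma tens_bilin (V W : vectType K) : bilin (@tens V W).
Proof.
split=> [v a w1 w2 | w a v1 v2]; rewrite /tens linearP /=.
  by rewrite mulmxDr scalemxAr.
by rewrite linearP /= mulmxDl scalemxAl.
Qed.

Lemma tlift_linear (V W U : vectType K) (f : V -> W -> U) : linear (tlift f).
Proof.
move=> a s t; rewrite /tlift scaler_sumr -big_split /=; apply: eq_bigr => i _.
rewrite scaler_sumr -big_split /=; apply: eq_bigr => j _.
by rewrite !mxE scalerDl scalerA.
Qed.

Lemma bilin_sumE (V W U : vectType K) (f : V -> W -> U) v w : bilin f ->
  f v w = \sum_i \sum_j (v2r v 0 i * v2r w 0 j) *:
            f (r2v (delta_mx 0 i)) (r2v (delta_mx 0 j)).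
Proof.
move=> [fr fl].
pose gr v : {linear W -> U} :=
  HB.pack (f v) (GRing.isLinear.Build K W U *:%R (f v) (fr v)).
pose gl w : {linear V -> U} :=
  HB.pack (f^~ w) (GRing.isLinear.Build K V U *:%R (f^~ w) (fl w)).
have basisE (X : vectType K) (x : X) :
    x = \sum_i v2r x 0 i *: r2v (delta_mx 0 i).
  rewrite -[LHS]v2rK [v2r x in LHS]row_sum_delta linear_sum.
  by apply: eq_bigr => i _; rewrite linearZ.
have -> : f v w = gl w v by [].
rewrite {1}[v]basisE linear_sum; apply: eq_bigr => i _.
rewrite linearZ /=; have -> : forall v0, f v0 w = gr v0 w by [].
rewrite {1}[w]basisE linear_sum scaler_sumr; apply: eq_bigr => j _.
by rewrite linearZ scalerA.
Qed.

Lemma tlift_tens (V W U : vectType K) (f : V -> W -> U) v w :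
  bilin f -> tlift f (tens v w) = f v w.
Proof.
move=> fB; rewrite (bilin_sumE _ _ fB); apply: eq_bigr => i _.
by apply: eq_bigr => j _; rewrite mxE big_ord1 mxE.
Qed.

Lemma tlift_uniq (V W U : vectType K) (g : tensor V W -> U) :
  linear g -> g =1 tlift (fun v w => g (tens v w)).
Proof.
move=> gL t.
pose h : {linear tensor V W -> U} :=
  HB.pack g (GRing.isLinear.Build K _ U *:%R g gL).
have -> : g t = h t by [].
rewrite {1}[t]matrix_sum_delta linear_sum; apply: eq_bigr => i _.
rewrite linear_sum; apply: eq_bigr => j _; rewrite linearZ /=.
by rewrite /tens !r2vK trmx_delta mul_delta_mx.
Qed.

Definition tmap (V V' W W' : vectType K) (f : V -> V') (g : W -> W') :
    tensor V W -> tensor V' W' :=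
  tlift (fun v w => tens (f v) (g w)).

Definition tswap (V W : vectType K) : tensor V W -> tensor W V :=
  tlift (fun v w => tens w v).

Definition tassoc (U V W : vectType K) :
    tensor (tensor U V) W -> tensor U (tensor V W) :=
  tlift (fun t w => tlift (fun u v => tens u (tens v w)) t).

Definition tens_vs (V W : vectType K) (X : {vspace V}) (Y : {vspace W}) :
    {vspace tensor V W} :=
  <<[seq tens v w | v <- vbasis X, w <- vbasis Y]>>%VS.

End Tensor.

Notation "V \ox W" := (tensor V W) (at level 40, left associativity).
Notation "v \tens w" := (tens v w) (at level 40, left associativity).

(* The group ring K[G]: functions G -> K under convolution (the default ring
   structure on finite functions is pointwise, hence the alias). *)
Definition groupAlg (K : fieldType) (gT : finGroupType) : Type :=
  {ffun gT -> K^o}.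

HB.instance Definition _ (K : fieldType) (gT : finGroupType) :=
  Vector.copy (groupAlg K gT) {ffun gT -> K^o}.

Section GroupAlg.
Variables (K : fieldType) (gT : finGroupType).
Local Notation KG := (groupAlg K gT).

Definition gelt (g : gT) : KG := [ffun h => (h == g)%:R].

Definition gmul (a b : KG) : KG :=
  [ffun g => \sum_(h : gT) (a h : K) * b (h^-1 * g)%g].

Let gmulA : associative gmul.
Proof.
move=> a b c; apply/ffunP=> g; rewrite !ffunE.
under eq_bigr => h _ do rewrite ffunE mulr_sumr.
under [RHS]eq_bigr => h _ do rewrite ffunE mulr_suml.
rewrite [RHS]exchange_big /=; apply: eq_bigr => h _.
rewrite (reindex_inj (mulgI h^-1)%g) /=; apply: eq_bigr => k _.
by rewrite invMg invgK !mulgA mulgK mulrA.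
Qed.

Let gmul1l : left_id (gelt 1) gmul.
Proof.
move=> a; apply/ffunP=> g; rewrite ffunE (bigD1 1%g) //= big1 => [|h /negPf h1].
  by rewrite ffunE eqxx mul1r invg1 mul1g addr0.
by rewrite ffunE h1 mul0r.
Qed.

Let gmul1r : right_id (gelt 1) gmul.
Proof.
move=> a; apply/ffunP=> g; rewrite ffunE (bigD1 g) //= big1 => [|h hg].
  by rewrite ffunE mulVg eqxx mulr1 addr0.
by rewrite ffunE -eq_mulVg1 (negPf hg) mulr0.
Qed.

Let gmulDl : left_distributive gmul +%R.
Proof.
move=> a b c; apply/ffunP=> g; rewrite !ffunE -big_split /=.
by apply: eq_bigr => h _; rewrite ffunE mulrDl.
Qed.

Let gmulDr : right_distributive gmul +%R.
Proof.
move=> a b c; apply/ffunP=> g; rewrite !ffunE -big_split /=.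
by apply: eq_bigr => h _; rewrite ffunE mulrDr.
Qed.

Let gelt1_neq0 : gelt 1 != 0.
Proof.
by apply/eqP => /ffunP/(_ 1%g); rewrite !ffunE eqxx; apply/eqP/oner_neq0.
Qed.

HB.instance Definition _ := GRing.Zmodule_isNzRing.Build KG
  gmulA gmul1l gmul1r gmulDl gmulDr gelt1_neq0.

Let gscaleAl (k : K) (a b : KG) : k *: (a * b) = k *: a * b.
Proof.
apply/ffunP=> g; rewrite !ffunE scaler_sumr.
by apply: eq_bigr => h _; rewrite ffunE; apply: mulrA.
Qed.

HB.instance Definition _ := GRing.Lmodule_isLalgebra.Build K KG gscaleAl.

Let gscaleAr (k : K) (a b : KG) : k *: (a * b) = a * (k *: b).
Proof.
apply/ffunP=> g; rewrite !ffunE scaler_sumr.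
by apply: eq_bigr => h _; rewrite ffunE; apply: mulrCA.
Qed.

HB.instance Definition _ := GRing.Lalgebra_isAlgebra.Build K KG gscaleAr.

Lemma geltM (g h : gT) : gelt (g * h)%g = gelt g * gelt h.
Proof.
apply/ffunP=> k; rewrite !ffunE (bigD1 g) //= big1 => [|l /negPf lg].
  by rewrite !ffunE eqxx mul1r addr0 -[in RHS](inj_eq (mulgI g)) mulKVg.
by rewrite ffunE lg mul0r.
Qed.

Definition KGcomul (a : KG) : KG \ox KG := \sum_g (a g : K) *: (gelt g \tens gelt g).
Definition KGcounit (a : KG) : K^o := \sum_g a g.
Definition KGantip (a : KG) : KG := \sum_g (a g : K) *: gelt g^-1%g.

End GroupAlg.

Section YetterDrinfeld.
Variables (K : fieldType) (gT : finGroupType).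
Local Notation H := (groupAlg K gT).

Record ydstr (V : vectType K) := YDStr {
  ydact : H -> V -> V;
  ydcoact : V -> H \ox V }.

(* The compatibility condition is the one for abelian groups. *)
Record is_yd (V : vectType K) (S : ydstr V) : Prop := {
  yd_act_bilin : bilin (ydact S);
  yd_act1 : forall v, ydact S 1 v = v;
  yd_actM : forall h k v, ydact S (h * k) v = ydact S h (ydact S k v);
  yd_coact_lin : linear (ydcoact S);
  yd_coassoc : forall v,
    tassoc (tmap (@KGcomul K gT) id (ydcoact S v)) = tmap id (ydcoact S) (ydcoact S v);
  yd_counit : forall v, tlift (fun (h : H) (w : V) => (KGcounit h : K) *: w) (ydcoact S v) = v;
  yd_compat : forall h v, ydcoact S (ydact S h v) = tmap id (ydact S h) (ydcoact S v) }.

Definition yd_triv (V : vectType K) : ydstr V :=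
  YDStr (fun (h : H) (v : V) => (KGcounit h : K) *: v) (fun v => (1 : H) \tens v).

Definition yd_tens (V W : vectType K) (S : ydstr V) (S' : ydstr W) :
    ydstr (V \ox W) :=
  YDStr
    (fun h t =>
      tlift (fun h1 h2 : H => tmap (ydact S h1) (ydact S' h2) t) (KGcomul h))
    (tlift (fun (v : V) (w : W) =>
      tlift (fun (h : H) (v2 : V) =>
        tlift (fun (k : H) (w2 : W) => (h * k) \tens (v2 \tens w2)) (ydcoact S' w)) (ydcoact S v))).

Definition yd_mor (V W : vectType K) (S : ydstr V) (S' : ydstr W)
    (f : V -> W) : Prop :=
  [/\ linear f,
      forall h v, f (ydact S h v) = ydact S' h (f v) &
      forall v, ydcoact S' (f v) = tmap id f (ydcoact S v)].

Definition yd_braid (V W : vectType K) (S : ydstr V) (S' : ydstr W) :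
    V \ox W -> W \ox V :=
  tlift (fun (v : V) (w : W) =>
    tlift (fun (h : H) (v2 : V) => ydact S' h w \tens v2) (ydcoact S v)).

Definition trivial_on (V : vectType K) (S : ydstr V) (C : {vspace V}) : Prop :=
  forall a a', a \in C -> a' \in C -> yd_braid S S (a \tens a') = a' \tens a.

Definition completely_trivial_on (V : vectType K) (S : ydstr V)
    (C : {vspace V}) : Prop :=
  (forall h a, a \in C -> ydact S h a = (KGcounit h : K) *: a) /\
  (forall a, a \in C -> ydcoact S a = (1 : H) \tens a).

Record ydhopf (A : falgType K) := YDHopf {
  ydh_str :> ydstr A;
  comul : A -> A \ox A;
  counit : A -> K^o;
  antip : A -> A }.

Section Hopf.
Variables (A : falgType K) (D : ydhopf A).

(* product of the ordinary tensor product algebra *)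
Definition tmul (s t : A \ox A) : A \ox A :=
  tlift (fun a b : A => tlift (fun a' b' : A => (a * a') \tens (b * b')) t) s.

(* (a (x) b)(a' (x) b') = a (b^(1).a') (x) b^(2) b' *)
Definition bmul (s t : A \ox A) : A \ox A :=
  tlift (fun a b : A =>
    tlift (fun a' b' : A =>
      tlift (fun (h : H) (b2 : A) => (a * ydact D h a') \tens (b2 * b')) (ydcoact D b)) t) s.

Record is_ydhopf : Prop := {
  ydh_yd : is_yd D;
  ydh_mul : yd_mor (yd_tens D D) D (tlift (fun a b : A => a * b));
  ydh_unit : yd_mor (yd_triv K^o) D (fun k : K^o => (k : K)%:A);
  ydh_comul : yd_mor D (yd_tens D D) (comul D);
  ydh_counit : yd_mor D (yd_triv K^o) (counit D);
  ydh_antip : yd_mor D D (antip D);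
  ydh_coassoc : forall a,
    tassoc (tmap (comul D) id (comul D a)) = tmap id (comul D) (comul D a);
  ydh_counitl : forall a, tlift (fun b c : A => (counit D b : K) *: c) (comul D a) = a;
  ydh_counitr : forall a, tlift (fun b c : A => (counit D c : K) *: b) (comul D a) = a;
  ydh_comul1 : comul D 1 = 1 \tens 1;
  ydh_comulM : forall a b, comul D (a * b) = bmul (comul D a) (comul D b);
  ydh_counit1 : counit D 1 = 1;
  ydh_counitM : forall a b, counit D (a * b) = (counit D a : K) * counit D b;
  ydh_antipl : forall a,
    tlift (fun b c : A => antip D b * c) (comul D a) = (counit D a : K)%:A;
  ydh_antipr : forall a,
    tlift (fun b c : A => b * antip D c) (comul D a) = (counit D a : K)%:A }.

Definition cocommutative : Prop := forall a, tswap (comul D a) = comul D a.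

Definition subcoalgebra (C : {vspace A}) : Prop :=
  forall a, a \in C -> comul D a \in tens_vs C C.

Definition simple_subcoalgebra (C : {vspace A}) : Prop :=
  [/\ C != 0%VS, subcoalgebra C &
      forall C', (C' <= C)%VS -> subcoalgebra C' -> C' = 0%VS \/ C' = C].

(* A is the sum of its simple subcoalgebras *)
Definition cosemisimple : Prop :=
  exists s : seq {vspace A},
    (forall C, C \in s -> simple_subcoalgebra C) /\
    (\sum_(C <- s) C)%VS = fullv.

Definition grouplike (a : A) : Prop :=
  comul D a = a \tens a /\ counit D a = 1.

(* eta' has a nonzero coefficient in the expansion of a in a basis of group-like
   elements (which, if it exists, consists of all group-like elements) *)
Definition appears_in (eta' a : A) : Prop :=
  exists (n : nat) (X : n.-tuple A) (i : 'I_n),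
    [/\ basis_of fullv X, forall b, b \in X -> grouplike b,
        tnth X i = eta' & coord X i a != 0].

Definition grouplike_spanned (C : {vspace A}) : Prop :=
  exists s : seq A, (forall b, b \in s -> grouplike b) /\ C = <<s>>%VS.

(* The core does not depend on the choice of eta'; [is_core] asks for C to be
   the core for every choice, and that a choice is possible. *)
Definition is_core (eta : A) (C : {vspace A}) : Prop :=
  (exists eta', appears_in eta' (antip D eta)) /\
  forall eta', appears_in eta' (antip D eta) ->
    [/\ grouplike_spanned C, eta * eta' \in C &
        forall C', grouplike_spanned C' -> eta * eta' \in C' -> (C <= C')%VS].

Definition is_linchar (chi : gT -> K) : Prop :=
  chi 1%g = 1 /\ forall g h, chi (g * h)%g = chi g * chi h.

Definition char_ext (chi : gT -> K) (h : H) : K := \sum_g h g * chi g.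

Definition Tgrp (eta : A) : {set gT} := [set g | ydact D (gelt K g) eta == eta].

Definition in_Qgrp (eta : A) (chi : gT -> K) : Prop :=
  is_linchar chi /\ tlift (fun (h : H) (v : A) => char_ext chi h *: v) (ydcoact D eta) = eta.

Definition Qperp (eta : A) : {set gT} :=
  [set g | `[< forall chi, in_Qgrp eta chi -> chi g = 1 >]].

Lemma Qperp_group_set (eta : A) : group_set (Qperp eta).
Proof.
apply/group_setP; split=> [|g h].
  by rewrite inE; apply/asboolP=> chi [[]].
rewrite !inE => /asboolP Hg /asboolP Hh; apply/asboolP=> chi chiQ.
by case: (chiQ) => -[_ ->] _; rewrite Hg // Hh // mulr1.
Qed.

Canonical Qperp_group (eta : A) := Group (Qperp_group_set eta).

Definition index_grp (eta : A) : finGroupType :=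
  subg_of (Qperp_group eta / (Tgrp eta :&: Qperp eta))%G.

(* K[G] -> K[index_grp eta]: g in Q^perp goes to its coset; the components
   outside K[Q^perp], which do not occur in the coaction of the core, go to 0 *)
Definition index_proj (eta : A) (h : H) : groupAlg K (index_grp eta) :=
  \sum_(g in Qperp eta) (h g : K) *:
     gelt K (subg _ (coset (Tgrp eta :&: Qperp eta) g) : index_grp eta).

End Hopf.
End YetterDrinfeld.

(* The structure of the core of eta over the group ring of the index group,
   meaningful on the core only (so that cosets ydact through representatives). *)
Definition core_str (K : fieldType) (gT : finGroupType) (A : falgType K)
    (D : ydhopf gT A) (eta : A) : ydstr (index_grp D eta) A :=
  YDStr
    (fun h a => \sum_(u : index_grp D eta)
        (h u : K) *: ydact D (gelt K (repr (sgval u))) a)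
    (fun a => tmap (@index_proj K gT A D eta) id (ydcoact D a)).

(* The subspace C with the restricted structure maps is a Hopf algebra in the
   ordinary sense. *)
Record ordinary_hopf_on (K : fieldType) (gT : finGroupType) (A : falgType K)
    (D : ydhopf gT A) (C : {vspace A}) : Prop := {
  oh_1 : 1 \in C;
  oh_M : forall a b, a \in C -> b \in C -> a * b \in C;
  oh_comul : forall a, a \in C -> comul D a \in tens_vs C C;
  oh_antip : forall a, a \in C -> antip D a \in C;
  oh_comul_lin : linear (comul D);
  oh_counit_lin : linear (counit D);
  oh_antip_lin : linear (antip D);
  oh_coassoc : forall a, a \in C ->
    tassoc (tmap (comul D) id (comul D a)) = tmap id (comul D) (comul D a);
  oh_counitl : forall a, a \in C ->
    tlift (fun b c : A => (counit D b : K) *: c) (comul D a) = a;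
  oh_counitr : forall a, a \in C ->
    tlift (fun b c : A => (counit D c : K) *: b) (comul D a) = a;
  oh_comul1 : comul D 1 = 1 \tens 1;
  oh_comulM : forall a b, a \in C -> b \in C ->
    comul D (a * b) = tmul (comul D a) (comul D b);
  oh_counit1 : counit D 1 = 1;
  oh_counitM : forall a b, a \in C -> b \in C ->
    counit D (a * b) = (counit D a : K) * counit D b;
  oh_antipl : forall a, a \in C ->
    tlift (fun b c : A => antip D b * c) (comul D a) = (counit D a : K)%:A;
  oh_antipr : forall a, a \in C ->
    tlift (fun b c : A => b * antip D c) (comul D a) = (counit D a : K)%:A }.

(* f is an isomorphism of Hopf algebras from K[L] onto C; the group L need not
   be the group gT over which A is a Yetter-Drinfel'd Hopf algebra. *)
Record hopf_iso_onto (K : fieldType) (L gT : finGroupType) (A : falgType K)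
    (D : ydhopf gT A) (C : {vspace A}) (f : groupAlg K L -> A) : Prop := {
  hi_lin : linear f;
  hi_inj : injective f;
  hi_im : forall a, a \in C <-> exists h, f h = a;
  hi_1 : f 1 = 1;
  hi_M : {morph f : h k / h * k};
  hi_comul : forall h, comul D (f h) = tmap f f (KGcomul h);
  hi_counit : forall h, counit D (f h) = KGcounit h;
  hi_antip : forall h, antip D (f h) = f (KGantip h) }.

Definition alg_hom (K : fieldType) (A B : algType K) (f : A -> B) : Prop :=
  [/\ linear f, f 1 = 1 & {morph f : a b / a * b}].

Variant alg_kind := TypeI | TypeII.

Definition relations (t : alg_kind) (K : fieldType) (zeta : K)
    (B : algType K) (x y : B) : Prop :=
  match t with
  | TypeI =>
      [/\ x * y = y * x, x ^+ 4 = 1 &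
          y ^+ 2 = 2^-1 *: (1 + zeta *: x + x ^+ 2 - zeta *: x ^+ 3)]
  | TypeII =>
      [/\ x ^+ 4 = 1, x * y = y * x ^+ 3 &
          y ^+ 2 = 2^-1 *: (zeta *: 1 + x - zeta *: x ^+ 2 + x ^+ 3)]
  end.

(* A is the K-algebra generated by x and y subject to the relations above. *)
Definition presented (t : alg_kind) (K : fieldType) (zeta : K)
    (A : algType K) (x y : A) : Prop :=
  relations t zeta x y /\
  forall (B : algType K) (u v : B), relations t zeta u v ->
    (exists f : A -> B, [/\ alg_hom f, f x = u & f y = v]) /\
    (forall f g : A -> B, alg_hom f -> alg_hom g ->
       f x = g x -> f y = g y -> f =1 g).

Section Example.
Variable K : fieldType.

(* the group Z_2 x Z_2, written multiplicatively as a finGroupType *)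
Definition G22 : finGroupType := ('Z_2 * 'Z_2)%type.
Definition g1 : G22 := (0, 0).
Definition g2 : G22 := (1, 0).
Definition g3 : G22 := (0, 1).
Definition g4 : G22 := (1, 1).

Definition theta (zeta : K) (g h : G22) : K :=
  (zeta ^+ 2) ^+ (g.1 * h.1)%N * (-1) ^+ (g.1 * h.2 + g.2 * h.1)%N.

Lemma G22_cases (P : G22 -> Prop) : P g1 -> P g2 -> P g3 -> P g4 -> forall g, P g.
Proof.
have Z2P (a : 'Z_2) : a = 0 \/ a = 1.
  by case: a => -[|[|//]] ?; [left | right]; apply: val_inj.
by move=> ? ? ? ? [a b]; case: (Z2P a) => ->; case: (Z2P b) => ->.
Qed.

Lemma G22_mulE :
  (((g1 * g1 = g1)%g * (g1 * g2 = g2)%g * (g1 * g3 = g3)%g * (g1 * g4 = g4)%g) *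
   ((g2 * g1 = g2)%g * (g2 * g2 = g1)%g * (g2 * g3 = g4)%g * (g2 * g4 = g3)%g) *
   ((g3 * g1 = g3)%g * (g3 * g2 = g4)%g * (g3 * g3 = g1)%g * (g3 * g4 = g2)%g) *
   ((g4 * g1 = g4)%g * (g4 * g2 = g3)%g * (g4 * g3 = g2)%g * (g4 * g4 = g1)%g)).
Proof. by do !split; apply/eqP. Qed.

(* theta is the symmetric bicharacter with theta(g2,g2) = zeta^2,
   theta(g2,g3) = -1 and theta(g3,g3) = 1. *)
Lemma theta_spec (zeta : K) (zeta4 : zeta ^+ 4 = 1) (th : G22 -> G22 -> K) :
  [/\ forall g g' h, th (g * g')%g h = th g h * th g' h,
      forall g h, th g h = th h g,
      forall g h, th g h != 0 &
      [/\ th g2 g2 = zeta ^+ 2, th g2 g3 = -1 & th g3 g3 = 1]]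
  <-> th =2 theta zeta.
Proof.
have z4 : zeta ^+ 2 * zeta ^+ 2 = 1 by rewrite -exprD.
have N1 : (-1) * (-1) = 1 :> K by rewrite mulrNN mulr1.
have z2 : zeta ^+ 2 != 0.
  by apply: contraTneq isT => z0; move: z4; rewrite z0 mul0r => /eqP; rewrite eq_sym oner_eq0.
have thE : (theta zeta g1 =1 fun=> 1) /\
  [/\ theta zeta g2 g1 = 1, theta zeta g2 g2 = zeta ^+ 2, theta zeta g2 g3 = -1
    & theta zeta g2 g4 = - zeta ^+ 2] /\
  [/\ theta zeta g3 g1 = 1, theta zeta g3 g2 = -1, theta zeta g3 g3 = 1
    & theta zeta g3 g4 = -1] /\
  [/\ theta zeta g4 g1 = 1, theta zeta g4 g2 = - zeta ^+ 2, theta zeta g4 g3 = -1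
    & theta zeta g4 g4 = zeta ^+ 2].
  split; first by apply: G22_cases; rewrite /theta /= ?expr0 ?mulr1.
  by rewrite /theta /= !expr0 !expr1 -?[(_ + _)%N]/(2%N) ?[(-1) ^+ _]expr2 ?N1 ?mulr1 ?mul1r ?mulrN1.
case: thE => [e1 [[e21 e22 e23 e24] [[e31 e32 e33 e34] [e41 e42 e43 e44]]]].
pose thE := (e1, e21, e22, e23, e24, e31, e32, e33, e34, (e41, e42, e43, e44)).
split=> [[thM thC th0 [t22 t23 t33]] | thth].
  have t1 h : th g1 h = 1.
    apply: (mulfI (th0 g1 h)); rewrite mulr1 -thM; congr (th _ h).
    by rewrite G22_mulE.
  have t4 h : th g4 h = th g2 h * th g3 h by rewrite -thM G22_mulE.
  apply: G22_cases; apply: G22_cases;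
    rewrite thE ?(thC _ g4) ?t4 ?(thC _ g1) ?t1 ?(thC g3 g2) ?t22 ?t23 ?t33 //;
    rewrite ?(thC _ g4) ?t4 ?(thC g3 g2) ?t22 ?t23 ?t33;
    by rewrite ?mulr1 ?mul1r ?mulrN1 ?mulNr ?mul1r ?mulrN ?mulr1 ?opprK.
split; first by apply: G22_cases; apply: G22_cases; apply: G22_cases;
  rewrite !thth ?G22_mulE ?thE ?mulrNN ?mulrN ?mulNr ?mulr1 ?mul1r ?opprK ?z4.
- by apply: G22_cases; apply: G22_cases; rewrite !thth !thE.
- by apply: G22_cases; apply: G22_cases; rewrite thth thE ?oppr_eq0 ?oner_eq0.
- by rewrite !thth !thE.
Qed.

Section Elements.
Variables (A : falgType K) (iota zeta : K) (x y : A).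

Definition omega1 : A := 1.
Definition omega2 : A :=
  (2^-1 * (1 + iota * zeta ^+ 2)) *: x + (2^-1 * (1 - iota * zeta ^+ 2)) *: x ^+ 3.
Definition omega3 : A :=
  (2^-1 * (1 - iota * zeta ^+ 2)) *: x + (2^-1 * (1 + iota * zeta ^+ 2)) *: x ^+ 3.
Definition omega4 : A := x ^+ 2.
Definition eta1 : A := y.
Definition eta2 : A := x ^+ 3 * y.
Definition eta3 : A := x ^+ 2 * y.
Definition eta4 : A := x * y.

Definition core_span : {vspace A} := <<[:: omega1; omega2; omega3; omega4]>>%VS.

Definition example_action (S : ydstr G22 A) : Prop :=
  let a g := ydact S (gelt K g) in
  [/\ bilin (ydact S),
      forall g, alg_hom (a g) /\ bijective (a g),
      a g1 =1 id,
      [/\ a g2 x = x ^+ 3, a g2 y = x ^+ 3 * y, a g3 x = x & a g3 y = x ^+ 2 * y] &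
      a g4 =1 a g2 \o a g3].

Definition example_coaction (S : ydstr G22 A) : Prop :=
  forall b, ydcoact S b =
    4^-1 *: \sum_g \sum_g' theta zeta g g' *: (gelt K g \tens ydact S (gelt K g') b).

Definition example_comul (D : ydhopf G22 A) : Prop :=
  [/\ linear (comul D), comul D 1 = 1 \tens 1,
      forall a b, comul D (a * b) = bmul D (comul D a) (comul D b),
      comul D x = 2^-1 *: (x \tens x + x \tens x ^+ 3 + x ^+ 3 \tens x
                           - x ^+ 3 \tens x ^+ 3) &
      comul D y = y \tens y].

Definition example_counit (D : ydhopf G22 A) : Prop :=
  [/\ alg_hom (counit D : A -> (K^o : algType K)), counit D x = 1 & counit D y = 1].

Definition example_antip (t : alg_kind) (D : ydhopf G22 A) : Prop :=
  let S := antip D in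
  [/\ linear S,
      [/\ S omega1 = omega1, S omega2 = omega2, S omega3 = omega3
        & S omega4 = omega4] &
      match t with
      | TypeI =>
        [/\ S eta1 = 2^-1 *: (eta1 + zeta^-1 *: eta2 + eta3 - zeta^-1 *: eta4),
            S eta2 = 2^-1 *: (zeta^-1 *: eta1 + eta2 - zeta^-1 *: eta3 + eta4),
            S eta3 = 2^-1 *: (eta1 - zeta^-1 *: eta2 + eta3 + zeta^-1 *: eta4) &
            S eta4 = 2^-1 *: (- (zeta^-1 *: eta1) + eta2 + zeta^-1 *: eta3 + eta4)]
      | TypeII =>
        [/\ S eta1 = 2^-1 *: (zeta^-1 *: eta1 + eta2 - zeta^-1 *: eta3 + eta4),
            S eta2 = 2^-1 *: (eta1 + zeta^-1 *: eta2 + eta3 - zeta^-1 *: eta4),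
            S eta3 = 2^-1 *: (- (zeta^-1 *: eta1) + eta2 + zeta^-1 *: eta3 + eta4) &
            S eta4 = 2^-1 *: (eta1 - zeta^-1 *: eta2 + eta3 + zeta^-1 *: eta4)]
      end].

Definition example_structure (t : alg_kind) (D : ydhopf G22 A) : Prop :=
  [/\ example_action D, example_coaction D, example_comul D, example_counit D &
      example_antip t D].

End Elements.
End Example.

(* Main.v *)
(** Since theta is nondegenerate, the coaction is determined by the action
    through the R-matrix R = 1/4 sum theta(g,g') g (x) g'; hence every linear
    equivariant map is colinear, all Yetter-Drinfel'd axioms reduce to statements
    about the action of G, and the associativity of the braided product is the
    Yang-Baxter equation for R.

    The algebra A is realized as R0 + R0 y with R0 = K[x]/(x^4 - 1), which shows
    that it has dimension 8.  The images of x and y under the coproduct satisfy the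
    relations of A in the braided tensor square, so the coproduct exists by the
    universal property; G permutes the basis omega_g, eta_g = g.y (g in G) of
    group-like elements, and the Hopf axioms are checked on this basis.  Every
    group-like element is one of these eight elements.  The element g_3 acts
    trivially on the span of the omega_g, hence the braiding is the flip there, while
    g_2 exchanges omega_2 and omega_3.  Finally S(eta_1) has nonzero coefficients
    exactly on the eta_g, and each product eta_1 eta_g is a combination of
    the omega_h with all four coefficients nonzero, which identifies the core. *)

From HB Require Import structures.
Require Import Defs.
From mathcomp Require Import all_boot all_order all_algebra all_fingroup all_field.
From mathcomp Require Import boolp ring.
Import GRing.Theory VectorInternalTheory.
Local Open Scope ring_scope.

Set Implicit Arguments.
Unset Strict Implicit.
Unset Printing Implicit Defensive.

(** * Tensor products and group rings *)

(** The assertions concern every algebra with the given presentation and every structure satisfying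
    the prescribed formulas. The computations therefore rest on the relations, the universal
    property and the normal form a(x) + b(x) y; the explicit model supplies the dimension and this
    normal form. The universal property speaks of algebras only, so the braided tensor square has to
    be made one before the coproduct can be obtained from it.

    The constant iota zeta^2 is a square root of -1. An element a x + b x^3 with a + b = 1 is
    group-like exactly when 2ab = 1, that is, a = (1 + c)/2 and b = (1 - c)/2 with c^2 = -1; the two
    signs of c give omega_2 and omega_3.

    The braiding degenerates on the core for a numerical reason: the sum of theta(g,g') over g and
    g' in cosets of {g_1, g_3} is 4 if both cosets are trivial and 0 otherwise. If only one argument
    runs over a coset, some nontrivial terms survive; this is the situation of a core element
    against y, and there the braiding is not the flip. *)

Section LinearProp.
Variables (K : fieldType) (V W : lmodType K) (f : V -> W).
Hypothesis lf : linear f.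
Let g : {linear V -> W} := HB.pack f (GRing.isLinear.Build K V W *:%R f lf).

(** The definitions express linearity by the predicate [linear f] on bare functions; packing [f]
    once makes the lemmas on bundled linear maps available for all of them. *)
Lemma linear_propD u v : f (u + v) = f u + f v.
Proof. exact: (linearD g). Qed.
Lemma linear_propN u : f (- u) = - f u.
Proof. exact: (linearN g). Qed.
Lemma linear_propZ a u : f (a *: u) = a *: f u.
Proof. exact: (linearZ_LR g). Qed.
Lemma linear_prop0 : f 0 = 0.
Proof. exact: (linear0 g). Qed.
Lemma linear_prop_sum I (r : seq I) (P : pred I) F :
  f (\sum_(i <- r | P i) F i) = \sum_(i <- r | P i) f (F i).
Proof. exact: (linear_sum g). Qed.
End LinearProp.

Lemma linear_comp (K : fieldType) (U V W : lmodType K) (f : V -> W) (g : U -> V) :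
  linear f -> linear g -> linear (f \o g).
Proof. by move=> lf lg a u v; rewrite /= lg lf. Qed.

Section TensorTheory.
Variable K : fieldType.
Implicit Types V W U : vectType K.

HB.instance Definition _ V W U (f : V -> W -> U) :=
  GRing.isLinear.Build K (V \ox W) U *:%R (tlift f) (tlift_linear f).

HB.instance Definition _ V W (v : V) :=
  GRing.isLinear.Build K W (V \ox W) *:%R (tens v) ((@tens_bilin K V W).1 v).

Lemma tens_linearl V W (w : W) : linear (fun v : V => v \tens w).
Proof. exact: (tens_bilin V W).2. Qed.

Lemma tensDl V W (v v' : V) (w : W) : (v + v') \tens w = v \tens w + v' \tens w.
Proof. exact: linear_propD (tens_linearl w) v v'. Qed.
Lemma tensNl V W (v : V) (w : W) : (- v) \tens w = - (v \tens w).
Proof. exact: linear_propN (tens_linearl w) v. Qed.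
Lemma tensZl V W a (v : V) (w : W) : (a *: v) \tens w = a *: (v \tens w).
Proof. exact: linear_propZ (tens_linearl w) a v. Qed.
Lemma tens_suml V W I (r : seq I) (P : pred I) F (w : W) :
  (\sum_(i <- r | P i) F i : V) \tens w = \sum_(i <- r | P i) F i \tens w.
Proof. exact: linear_prop_sum (tens_linearl w) _ _ _ _. Qed.
Lemma tensDr V W (v : V) (w w' : W) : v \tens (w + w') = v \tens w + v \tens w'.
Proof. exact: linearD. Qed.
Lemma tensNr V W (v : V) (w : W) : v \tens (- w) = - (v \tens w).
Proof. exact: linearN. Qed.
Lemma tensZr V W a (v : V) (w : W) : v \tens (a *: w) = a *: (v \tens w).
Proof. exact: linearZ_LR. Qed.
Lemma tens_sumr V W I (r : seq I) (P : pred I) F (v : V) :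
  v \tens (\sum_(i <- r | P i) F i : W) = \sum_(i <- r | P i) v \tens F i.
Proof. exact: linear_sum. Qed.

Definition tensE := (tensDl, tensDr, tensZl, tensZr, tensNl, tensNr).

(** Pure tensors span the tensor product, by [tlift_uniq]. This is the induction principle that
    reduces every identity on tensors below to pure tensors. *)
Lemma tens_ext V W U (F G : V \ox W -> U) : linear F -> linear G ->
  (forall v w, F (v \tens w) = G (v \tens w)) -> F =1 G.
Proof.
move=> lF lG FG t; rewrite (tlift_uniq lF) (tlift_uniq lG) /tlift.
by apply: eq_bigr => i _; apply: eq_bigr => j _; rewrite FG.
Qed.

Lemma bilin_tens V W V' W' (f : V -> V') (g : W -> W') : linear f -> linear g ->
  bilin (fun v w => f v \tens g w).
Proof.
by move=> lf lg; split=> [v a w w' | w a v v'] /=; rewrite ?lf ?lg !tensE.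
Qed.

Lemma tmap_tens V W V' W' (f : V -> V') (g : W -> W') v w : linear f -> linear g ->
  tmap f g (v \tens w) = f v \tens g w.
Proof. by move=> lf lg; rewrite /tmap tlift_tens //; exact: bilin_tens. Qed.

Lemma tmap_linear V W V' W' (f : V -> V') (g : W -> W') : linear (tmap f g).
Proof. exact: tlift_linear. Qed.

Lemma tswap_tens V W (v : V) (w : W) : tswap (v \tens w) = w \tens v.
Proof.
rewrite /tswap tlift_tens //.
by split=> [v' a u u' | w' a u u']; rewrite !tensE.
Qed.

Lemma tassoc_tens U V W (u : U) (v : V) (w : W) :
  tassoc (u \tens v \tens w) = u \tens (v \tens w).
Proof.
have b2 w' : bilin (fun (u : U) (v : V) => u \tens (v \tens w')).
  by split=> [x a y y' | x a y y']; rewrite !tensE.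
rewrite /tassoc tlift_tens ?tlift_tens //; split=> [t a w1 w2 | w1 a t t'].
  rewrite /tlift scaler_sumr -big_split; apply: eq_bigr => i _ /=.
  rewrite scaler_sumr -big_split; apply: eq_bigr => j _ /=.
  by rewrite !tensE scalerDr !scalerA mulrC.
exact: tlift_linear.
Qed.

Lemma tassoc_linear U V W : linear (@tassoc K U V W).
Proof. exact: tlift_linear. Qed.

Lemma tlift_linear_param V W U (X : lmodType K) (f : X -> V -> W -> U) t :
  (forall v w, linear (fun x => f x v w)) -> linear (fun x => tlift (f x) t).
Proof.
move=> lf a x y; rewrite /tlift scaler_sumr -big_split; apply: eq_bigr => i _.
rewrite /= scaler_sumr -big_split; apply: eq_bigr => j _.
by rewrite lf scalerDr !scalerA mulrC.
Qed.

Lemma tmap_linear_l V W V' W' (U : lmodType K) (f : U -> V -> V') (g : W -> W') t :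
  (forall v, linear (f^~ v)) -> linear (fun h => tmap (f h) g t).
Proof. by move=> lf; apply: tlift_linear_param => v w a u u'; rewrite lf !tensE. Qed.

Lemma tmap_linear_r V W V' W' (U : lmodType K) (f : V -> V') (g : U -> W -> W') t :
  (forall w, linear (g^~ w)) -> linear (fun h => tmap f (g h) t).
Proof. by move=> lg; apply: tlift_linear_param => v w a u u'; rewrite lg !tensE. Qed.

End TensorTheory.

Section GroupAlgTheory.
Variables (K : fieldType) (gT : finGroupType).
Local Notation KG := (groupAlg K gT).

Lemma groupAlgE (h : KG) : h = \sum_g (h g : K) *: gelt K g.
Proof.
apply/ffunP=> g; rewrite sum_ffunE (bigD1 g) //= big1 => [|k kg].
  by rewrite !ffunE eqxx addr0 [RHS]mulr1.
by rewrite !ffunE eq_sym (negPf kg) [LHS]mulr0.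
Qed.

Lemma groupAlg_ext (V : lmodType K) (F G : KG -> V) : linear F -> linear G ->
  (forall g, F (gelt K g) = G (gelt K g)) -> F =1 G.
Proof.
move=> lF lG FG h; rewrite (groupAlgE h) (linear_prop_sum lF) (linear_prop_sum lG).
by apply: eq_bigr => g _; rewrite (linear_propZ lF) (linear_propZ lG) FG.
Qed.

Lemma linear_groupAlgE (V : lmodType K) (F : KG -> V) h : linear F ->
  F h = \sum_g (h g : K) *: F (gelt K g).
Proof.
move=> lF; rewrite {1}(groupAlgE h) (linear_prop_sum lF).
by apply: eq_bigr => g _; rewrite (linear_propZ lF).
Qed.

Lemma linear_coefs (V : lmodType K) (F : gT -> V) :
  linear (fun h : KG => \sum_g (h g : K) *: F g).
Proof.
move=> a h k; rewrite scaler_sumr -big_split; apply: eq_bigr => g _ /=.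
by rewrite !ffunE scalerDl scalerA.
Qed.

Lemma sum_gelt (V : lmodType K) (F : gT -> V) (g : gT) :
  \sum_k (gelt K g k : K) *: F k = F g.
Proof.
rewrite (bigD1 g) //= big1 => [|k /negPf kg].
  by rewrite ffunE eqxx scale1r addr0.
by rewrite ffunE kg scale0r.
Qed.

Lemma KGcomul_linear : linear (@KGcomul K gT).
Proof. exact: linear_coefs. Qed.

Lemma KGcomul_gelt (g : gT) : KGcomul (gelt K g) = gelt K g \tens gelt K g.
Proof. exact: sum_gelt. Qed.

Lemma KGcounit_linear : linear (@KGcounit K gT).
Proof.
move=> a h k; rewrite /KGcounit scaler_sumr -big_split.
by apply: eq_bigr => g _; rewrite !ffunE.
Qed.

Lemma KGcounit_gelt (g : gT) : KGcounit (gelt K g) = 1.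
Proof.
rewrite /KGcounit (bigD1 g) //= big1 => [|k /negPf kg].
  by rewrite ffunE eqxx addr0.
by rewrite ffunE kg.
Qed.

Lemma KGantip_linear : linear (@KGantip K gT).
Proof. exact: linear_coefs. Qed.

Lemma KGantip_gelt (g : gT) : KGantip (gelt K g) = gelt K g^-1%g.
Proof. exact: sum_gelt. Qed.

End GroupAlgTheory.

(** * Modules over a group ring with a bicharacter *)

Section RMatrix.
Variables (K : fieldType) (gT : finGroupType) (th : gT -> gT -> K).

(* contraction with the R-matrix |G|^-1 sum theta(g,g') g (x) g' of K[G] *)
Definition rsum (V : lmodType K) (F : gT -> gT -> V) : V :=
  #|gT|%:R^-1 *: \sum_g \sum_g' th g g' *: F g g'.

(** Nondegeneracy is recorded in the form in which it is applied, as the two orthogonality relations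
    [bich_suml] and [bich_sumr]. *)
Record bicharacter : Prop := Bicharacter {
  bichMl : forall g g' h, th (g * g')%g h = th g h * th g' h;
  bichMr : forall g h h', th g (h * h')%g = th g h * th g h';
  bich_suml : forall h, \sum_g th g h = (#|gT| * (h == 1%g))%:R;
  bich_sumr : forall g, \sum_h th g h = (#|gT| * (g == 1%g))%:R;
  bich_abelian : forall g h : gT, (g * h)%g = (h * g)%g;
  bich_card : #|gT|%:R != 0 :> K }.

Hypothesis thP : bicharacter.

Lemma eq_rsum (V : lmodType K) (F F' : gT -> gT -> V) :
  (forall g g', F g g' = F' g g') -> rsum F = rsum F'.
Proof.
move=> FF'; congr (_ *: _); apply: eq_bigr => g _; apply: eq_bigr => g' _.
by rewrite FF'.
Qed.

Lemma linear_rsum (V W : lmodType K) (f : V -> W) F : linear f ->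
  f (rsum F) = rsum (fun g g' => f (F g g')).
Proof.
move=> lf; rewrite (linear_propZ lf) (linear_prop_sum lf); congr (_ *: _).
apply: eq_bigr => g _; rewrite (linear_prop_sum lf); apply: eq_bigr => g' _.
by rewrite (linear_propZ lf).
Qed.

Lemma rsum_linear (V W : lmodType K) (f : gT -> gT -> V -> W) :
  (forall g g', linear (f g g')) -> linear (fun v => rsum (fun g g' => f g g' v)).
Proof.
move=> lf a u v; rewrite /rsum scalerA mulrC -scalerA -scalerDr; congr (_ *: _).
rewrite scaler_sumr -big_split; apply: eq_bigr => g _ /=.
rewrite scaler_sumr -big_split; apply: eq_bigr => g' _ /=.
by rewrite lf scalerDr !scalerA mulrC.
Qed.

(** This is (id (x) eps)(R) = 1: by orthogonality the sum over the free second leg vanishes unless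
    the first leg is the unit. *)
Lemma rsum_left (V : lmodType K) (F : gT -> V) : rsum (fun g _ => F g) = F 1%g.
Proof.
rewrite /rsum (bigD1 1%g) //= [X in _ + X]big1 => [|g g1].
  rewrite addr0 -scaler_suml (bich_sumr thP) eqxx muln1 scalerA mulVf ?scale1r //.
  exact: bich_card thP.
by rewrite -scaler_suml (bich_sumr thP) (negPf g1) muln0 scale0r.
Qed.

Lemma rsum_right (V : lmodType K) (F : gT -> V) : rsum (fun _ g' => F g') = F 1%g.
Proof.
rewrite /rsum exchange_big (bigD1 1%g) //= [X in _ + X]big1 => [|g g1].
  rewrite addr0 -scaler_suml (bich_suml thP) eqxx muln1 scalerA mulVf ?scale1r //.
  exact: bich_card thP.
by rewrite -scaler_suml (bich_suml thP) (negPf g1) muln0 scale0r.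
Qed.

(** Brings all four sums to the outside, so that they can be exchanged and reindexed freely. *)
Lemma rsum2E (V : lmodType K) (F : gT -> gT -> gT -> gT -> V) :
  rsum (fun g g' => rsum (fun h h' => F g g' h h')) =
  #|gT|%:R^-1 *: (#|gT|%:R^-1 *: \sum_g \sum_g' \sum_h \sum_h'
     (th g g' * th h h') *: F g g' h h').
Proof.
congr (_ *: _); rewrite scaler_sumr; apply: eq_bigr => g _.
rewrite scaler_sumr; apply: eq_bigr => g' _.
rewrite scalerA mulrC -scalerA; congr (_ *: _).
rewrite scaler_sumr; apply: eq_bigr => h _.
rewrite scaler_sumr; apply: eq_bigr => h' _.
by rewrite scalerA.
Qed.

Lemma rsumC (V : lmodType K) (F : gT -> gT -> gT -> gT -> V) :
  rsum (fun g g' => rsum (fun h h' => F g g' h h')) =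
  rsum (fun h h' => rsum (fun g g' => F g g' h h')).
Proof.
rewrite !rsum2E; congr (_ *: (_ *: _)).
under eq_bigr => g _ do rewrite exchange_big.
rewrite exchange_big; apply: eq_bigr => h _ /=.
under eq_bigr => g _ do rewrite exchange_big.
rewrite exchange_big; apply: eq_bigr => h' _ /=.
by apply: eq_bigr => g _; apply: eq_bigr => g' _; rewrite mulrC.
Qed.

(* the Yang-Baxter equation for the R-matrix, in the form of a reindexing *)
Lemma rsum_shift (V : lmodType K) (F : gT -> gT -> gT -> gT -> V) :
  rsum (fun g g' => rsum (fun h h' => F g h (h' * g')%g h')) =
  rsum (fun g g' => rsum (fun h h' => F g (g * h)%g g' h')).
Proof.
rewrite !rsum2E; congr (_ *: (_ *: _)); apply: eq_bigr => g _.
(* Absorbing h' into g' turns the weight into theta(g, h'^-1 g') theta(h, h'). Replacing h by g h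
   then contributes theta(g, h'), which cancels the factor theta(g, h'^-1). *)
transitivity (\sum_g' \sum_h \sum_h'
    (th g (h'^-1 * g')%g * th h h') *: F g h g' h').
  rewrite exchange_big [RHS]exchange_big; apply: eq_bigr => h _ /=.
  rewrite exchange_big [RHS]exchange_big; apply: eq_bigr => h' _ /=.
  rewrite [RHS](reindex_inj (mulgI h')).
  by apply: eq_bigr => g' _; rewrite mulKg.
apply: eq_bigr => g' _; rewrite (reindex_inj (mulgI g)); apply: eq_bigr => h _.
apply: eq_bigr => h' _; rewrite (bichMl thP) mulrA -(bichMr thP).
by rewrite (bich_abelian thP _ h') mulKVg.
Qed.

(** The identity (Delta (x) id)(R) = R_13 R_23. It is [rsum_shift] for a function not depending on
    the last leg, where (id (x) eps)(R) = 1 collapses the contraction over h, h'. *)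
Lemma rsum_coassoc (V : lmodType K) (F : gT -> gT -> gT -> V) :
  rsum (fun g g' => rsum (fun h h' => F g h (h' * g')%g)) =
  rsum (fun g g' => F g g g').
Proof.
rewrite (rsum_shift (fun g h g' _ => F g h g')) rsumC (rsum_left (fun h => rsum _)).
by apply: eq_rsum => g g'; rewrite mulg1.
Qed.

(** The companion identity (id (x) Delta)(R) = R_12 R_13, obtained in the same way from [rsum_shift]
    with (eps (x) id)(R) = 1. *)
Lemma rsum_codiag (V : lmodType K) (F : gT -> gT -> gT -> V) :
  rsum (fun g g' => rsum (fun h h' => F (g * h)%g g' h')) =
  rsum (fun g g' => F g g' g').
Proof.
rewrite -(rsum_shift (fun _ k g' h' => F k g' h')) rsumC; apply: eq_rsum => h h'.
by rewrite (rsum_right (fun g' => F h (h' * g')%g h')) mulg1.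
Qed.

End RMatrix.

Section ThetaModules.
Variables (K : fieldType) (gT : finGroupType) (th : gT -> gT -> K).
Hypothesis thP : bicharacter th.
Local Notation H := (groupAlg K gT).
Implicit Types V W : vectType K.

Definition gact V (S : ydstr gT V) (g : gT) : V -> V := ydact S (gelt K g).

(** These are the Yetter-Drinfel'd modules in the image of the functor from [K[G]]-modules defined
    by the R-matrix. The class contains the base field and is closed under tensor products, so all
    objects occurring in the axioms belong to it. *)
Record theta_module V (S : ydstr gT V) : Prop := ThetaModule {
  tm_bilin : bilin (ydact S);
  tm_act1 : forall v, gact S 1 v = v;
  tm_actM : forall g h v, gact S (g * h)%g v = gact S g (gact S h v);
  tm_coact : forall v, ydcoact S v = rsum th (fun g g' => gelt K g \tens gact S g' v) }.

Lemma gact_linear V (S : ydstr gT V) g : theta_module S -> linear (gact S g).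
Proof. by move=> SP; apply: (tm_bilin SP).1. Qed.

Lemma ydactE V (S : ydstr gT V) h v : theta_module S ->
  ydact S h v = \sum_g (h g : K) *: gact S g v.
Proof. by move=> SP; rewrite (linear_groupAlgE h ((tm_bilin SP).2 v)). Qed.

Lemma ydcoact_linear V (S : ydstr gT V) : theta_module S -> linear (ydcoact S).
Proof.
move=> SP a u v; rewrite !(tm_coact SP).
apply: (@rsum_linear _ _ th V _ (fun g g' v => gelt K g \tens gact S g' v)) => g g' b x z.
by rewrite (gact_linear _ SP) !tensE.
Qed.

(** Coassociativity is [rsum_coassoc], the counit law is [rsum_right], and the compatibility
    condition holds because the group is abelian. *)
Lemma theta_module_yd V (S : ydstr gT V) : theta_module S -> is_yd S.
Proof.
move=> SP; split; first exact: tm_bilin SP.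
- exact: tm_act1 SP.
- move=> h k v; have lA h' := (tm_bilin SP).1 h'; have lB v' := (tm_bilin SP).2 v'.
  apply: (@groupAlg_ext _ _ _ (fun h => ydact S (h * k) v)
    (fun h => ydact S h (ydact S k v))) => [a x z | // | g].
    by rewrite mulrDl -scalerAl lB.
  apply: (@groupAlg_ext _ _ _ (fun k => ydact S (gelt K g * k) v)
    (fun k => ydact S (gelt K g) (ydact S k v))) => [a x z | a x z | g'].
  + by rewrite mulrDr -scalerAr lB.
  + by rewrite lB lA.
  + by rewrite -geltM; apply: (tm_actM SP).
- exact: ydcoact_linear.
- move=> v; rewrite !(tm_coact SP) !(linear_rsum _ _ (tmap_linear _ _)).
  rewrite (linear_rsum _ _ (@tassoc_linear _ _ _ _)).
  transitivity (rsum th (fun g g' =>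
      gelt K g \tens (gelt K g \tens gact S g' v) : H \ox (H \ox V))).
    apply: eq_rsum => g g'; rewrite tmap_tens ?KGcomul_gelt ?tassoc_tens //.
    exact: KGcomul_linear.
  rewrite -(rsum_coassoc thP
    (fun g h g' => gelt K g \tens (gelt K h \tens gact S g' v))).
  apply: eq_rsum => g g'; rewrite tmap_tens //; last exact: ydcoact_linear.
  rewrite (tm_coact SP) (linear_rsum _ _ ((tens_bilin _ _).1 _)).
  by apply: eq_rsum => h h'; rewrite (tm_actM SP).
- move=> v; rewrite (tm_coact SP) (linear_rsum _ _ (tlift_linear _)).
  transitivity (rsum th (fun _ g' => gact S g' v)).
    apply: eq_rsum => g g'; rewrite tlift_tens ?KGcounit_gelt ?scale1r //.
    split=> [h a x z | x a h k]; first by rewrite scalerDr !scalerA mulrC.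
    by rewrite KGcounit_linear scalerDl scalerA.
  by rewrite (rsum_right thP (fun g' => gact S g' v)) (tm_act1 SP).
move=> h v; apply: (@groupAlg_ext _ _ _ (fun h => ydcoact S (ydact S h v))
  (fun h => tmap id (ydact S h) (ydcoact S v))) => [a x z | | g].
- by rewrite ((tm_bilin SP).2 v) ydcoact_linear.
- by apply: tmap_linear_r; exact: (tm_bilin SP).2.
rewrite -[ydact S (gelt K g)]/(gact S g) !(tm_coact SP).
rewrite (linear_rsum _ _ (tmap_linear _ _)); apply: eq_rsum => g1 g1'.
rewrite tmap_tens //; last exact: (gact_linear g SP).
by rewrite -!(tm_actM SP) (bich_abelian thP).
Qed.

(** Since every g' acts as the identity, the contraction of R with the action is (id (x) eps)(R) =
    1, which is the trivial coaction. *)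
Lemma theta_module_triv : theta_module (yd_triv gT K^o).
Proof.
have tE g v : gact (yd_triv gT K^o) g v = v by rewrite /gact /= KGcounit_gelt scale1r.
split=> [|v|g h v|v]; rewrite ?tE //.
  split=> [h a u v | v a h k] /=; first by rewrite scalerDr !scalerA mulrC.
  by rewrite KGcounit_linear scalerDl scalerA.
transitivity (rsum th (fun g _ => gelt K g \tens v)); last first.
  by apply: eq_rsum => g g'; rewrite tE.
by rewrite (rsum_left thP (fun g => gelt K g \tens v)).
Qed.

Section TensorModule.
Variables (V W : vectType K) (S : ydstr gT V) (S' : ydstr gT W).
Hypotheses (SP : theta_module S) (SP' : theta_module S').

Lemma yd_tens_actE h t :
  ydact (yd_tens S S') h t = \sum_g (h g : K) *: tmap (gact S g) (gact S' g) t.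
Proof.
rewrite /= /KGcomul linear_sum; apply: eq_bigr => g _ /=; rewrite linearZ_LR /= tlift_tens //.
split=> h1; first by apply: tmap_linear_r; exact: (tm_bilin SP').2.
by apply: tmap_linear_l; exact: (tm_bilin SP).2.
Qed.

Lemma yd_tens_gact g : gact (yd_tens S S') g =1 tmap (gact S g) (gact S' g).
Proof.
by move=> t; rewrite /gact yd_tens_actE (sum_gelt (fun g => tmap (gact S g) _ t)).
Qed.

(** The codiagonal coaction uses one copy of R for each factor; [rsum_codiag] merges the two copies
    into the single R that contracts with the diagonal action. *)
Lemma theta_module_tens : theta_module (yd_tens S S').
Proof.
have lA g := gact_linear g SP; have lA' g := gact_linear g SP'.
split=> [|t|g h t|].
- split=> [h a t t' | t a h k].
    rewrite !yd_tens_actE scaler_sumr -big_split; apply: eq_bigr => g _ /=.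
    by rewrite tmap_linear scalerDr !scalerA mulrC.
  by rewrite !yd_tens_actE linear_coefs.
- rewrite yd_tens_gact; move: t; apply: tens_ext => [||v w] //.
    exact: tmap_linear.
  by rewrite tmap_tens // (tm_act1 SP) (tm_act1 SP').
- rewrite !yd_tens_gact; move: t; apply: tens_ext => [||v w].
  + exact: tmap_linear.
  + exact: (linear_comp (tmap_linear _ _) (tmap_linear _ _)).
  + by rewrite !tmap_tens // (tm_actM SP) (tm_actM SP').
move=> t; transitivity (rsum th (fun g g' =>
  gelt K g \tens tmap (gact S g') (gact S' g') t)); last first.
  by apply: eq_rsum => g g'; rewrite yd_tens_gact.
move: t; apply: tens_ext => [||v w]; first exact: tlift_linear.
  apply: (@rsum_linear _ _ th _ _ (fun g g' t =>
    gelt K g \tens tmap (gact S g') (gact S' g') t)) => g g' a t t'.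
  by rewrite tmap_linear !tensE.
have bF (w2 : W) (k : H) : bilin (fun (h : H) (v2 : V) => (h * k) \tens (v2 \tens w2)).
  by split=> [x a z z' | x a z z']; rewrite ?mulrDl -?scalerAl !tensE.
have bG (h : H) (v2 : V) : bilin (fun (k : H) (w2 : W) => (h * k) \tens (v2 \tens w2)).
  by split=> [x a z z' | x a z z']; rewrite ?mulrDr -?scalerAr !tensE.
have E v' w' : tlift (fun (h : H) (v2 : V) =>
        tlift (fun (k : H) (w2 : W) => (h * k) \tens (v2 \tens w2)) (ydcoact S' w'))
        (ydcoact S v')
   = rsum th (fun g g' => rsum th (fun h h' =>
        (gelt K (g * h)%g) \tens (gact S g' v' \tens gact S' h' w'))).
  rewrite (tm_coact SP) (linear_rsum _ _ (tlift_linear _)).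
  apply: eq_rsum => g g'; rewrite tlift_tens.
    rewrite (tm_coact SP') (linear_rsum _ _ (tlift_linear _)).
    by apply: eq_rsum => h h'; rewrite tlift_tens // geltM.
  by split=> [h | v1]; apply: tlift_linear_param => k w2; [case: (bF w2 k) | case: (bF w2 k)].
rewrite /= tlift_tens ?E.
  rewrite (rsum_codiag thP (fun g g' h' =>
    gelt K g \tens (gact S g' v \tens gact S' h' w))).
  by apply: eq_rsum => g g'; rewrite tmap_tens.
split=> [v' a w1 w2 | w' a v1 v2].
  rewrite !E; move: a w1 w2; apply: rsum_linear => g g' ; apply: rsum_linear => h h' a w1 w2.
  by rewrite lA' !tensE.
rewrite !E; move: a v1 v2; apply: rsum_linear => g g' ; apply: rsum_linear => h h' a w1 w2.
by rewrite lA !tensE.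
Qed.

End TensorModule.
End ThetaModules.

Section ThetaMorphisms.
Variables (K : fieldType) (gT : finGroupType) (th : gT -> gT -> K).
Hypothesis thP : bicharacter th.
Implicit Types V W : vectType K.

Lemma theta_module_mor V W (S : ydstr gT V) (S' : ydstr gT W) (f : V -> W) :
  theta_module th S -> theta_module th S' -> linear f ->
  (forall g v, f (gact S g v) = gact S' g (f v)) -> yd_mor S S' f.
Proof.
move=> SP SP' lf fE; split=> // [h v | v].
  rewrite (ydactE _ _ SP) (ydactE _ _ SP') (linear_prop_sum lf).
  by apply: eq_bigr => g _; rewrite (linear_propZ lf) fE.
rewrite (tm_coact SP) (tm_coact SP') (linear_rsum _ _ (tmap_linear _ _)).
by apply: eq_rsum => g g'; rewrite tmap_tens // fE.
Qed.

Lemma yd_braid_tens V W (S : ydstr gT V) (S' : ydstr gT W) v w :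
  theta_module th S -> theta_module th S' ->
  yd_braid S S' (v \tens w) =
    rsum th (fun g g' => gact S' g w \tens gact S g' v).
Proof.
move=> SP SP'.
have bF w' : bilin (fun (h : groupAlg K gT) (v2 : V) => ydact S' h w' \tens v2).
  by split=> [h a x z | v2 a h k]; rewrite ?(tm_bilin SP').2 !tensE.
have E v' w' : tlift (fun (h : groupAlg K gT) (v2 : V) => ydact S' h w' \tens v2)
    (ydcoact S v') = rsum th (fun g g' => gact S' g w' \tens gact S g' v').
  rewrite (tm_coact SP) (linear_rsum _ _ (tlift_linear _)).
  by apply: eq_rsum => g g'; rewrite tlift_tens.
have lA g := gact_linear g SP; have lA' g := gact_linear g SP'.
rewrite /yd_braid tlift_tens ?E //; split=> [v' a w1 w2 | w' a v1 v2]; rewrite !E.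
  by move: a w1 w2; apply: rsum_linear => g g' k x z; rewrite lA' !tensE.
by move: a v1 v2; apply: rsum_linear => g g' k x z; rewrite lA !tensE.
Qed.

Section BraidedProduct.
Variables (A : falgType K) (D : ydhopf gT A).
Hypothesis DP : theta_module th D.

Lemma bmul_tens (a b c d : A) : bmul D (a \tens b) (c \tens d) =
  rsum th (fun g g' => (a * gact D g c) \tens (gact D g' b * d)).
Proof.
move: a b c d; have lA g := gact_linear g DP; have lB v := (tm_bilin DP).2 v.
have bF (a c d : A) : bilin (fun (h : groupAlg K gT) (b2 : A) => (a * ydact D h c) \tens (b2 * d)).
  split=> [h k x z | v2 k h h'] /=; first by rewrite mulrDl -scalerAl !tensE.
  by rewrite lB mulrDr -scalerAr !tensE.
have E (a b c d : A) : tlift (fun (h : groupAlg K gT) (b2 : A) => (a * ydact D h c) \tens (b2 * d))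
   (ydcoact D b) = rsum th (fun g g' => (a * gact D g c) \tens (gact D g' b * d)).
  rewrite (tm_coact DP) (linear_rsum _ _ (tlift_linear _)).
  by apply: eq_rsum => g g'; rewrite tlift_tens.
have bG (a b : A) : bilin (fun c d : A => tlift (fun (h : groupAlg K gT) (b2 : A) =>
    (a * ydact D h c) \tens (b2 * d)) (ydcoact D b)).
  split=> [u k x z | u k x z]; rewrite !E; move: k x z; apply: rsum_linear => g g' k x z.
    by rewrite mulrDr -scalerAr !tensE.
  by rewrite lA mulrDr -scalerAr !tensE.
move=> a b c d; rewrite /bmul tlift_tens ?tlift_tens //.
split=> [u k x z | u k x z]; move: k x z; apply: tlift_linear_param => v w k x z;
  rewrite !E; move: k x z; apply: rsum_linear => g g' k x z.
  by rewrite lA mulrDl -scalerAl !tensE.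
by rewrite mulrDl -scalerAl !tensE.
Qed.

Lemma bmul_bilin : bilin (bmul D).
Proof.
split=> [s | t]; last exact: tlift_linear.
apply: tlift_linear_param => a b; exact: tlift_linear.
Qed.

Hypothesis D1 : forall g, gact D g 1 = 1.
Hypothesis DM : forall g a b, gact D g (a * b) = gact D g a * gact D g b.

Lemma bmul1t : left_id (1 \tens 1) (bmul D).
Proof.
apply: tens_ext => [|//|c d]; first exact: bmul_bilin.1.
rewrite bmul_tens (@eq_rsum _ _ th _ _ (fun g _ => gact D g c \tens d)) => [|g g'].
  by rewrite (rsum_left thP (fun g => gact D g c \tens d)) (tm_act1 DP).
by rewrite D1 !mul1r.
Qed.

Lemma bmult1 : right_id (1 \tens 1) (bmul D).
Proof.
apply: tens_ext => [|//|c d]; first exact: bmul_bilin.2.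
rewrite bmul_tens (@eq_rsum _ _ th _ _ (fun _ g => c \tens gact D g d)) => [|g g'].
  by rewrite (rsum_right thP (fun g => c \tens gact D g d)) (tm_act1 DP).
by rewrite D1 !mulr1.
Qed.

Lemma bmulA : associative (bmul D).
Proof.
have lA g := gact_linear g DP.
move=> r s t; move: r; apply: tens_ext => [|k x z|a b].
- exact: bmul_bilin.2.
- by rewrite !bmul_bilin.2.
move: s; apply: tens_ext => [k x z|k x z|a' b'].
- by rewrite bmul_bilin.2 bmul_bilin.1.
- by rewrite bmul_bilin.1 bmul_bilin.2.
move: t; apply: tens_ext => [k x z||a'' b''].
- by rewrite !bmul_bilin.1.
- exact: bmul_bilin.1.
rewrite !bmul_tens (linear_rsum _ _ (bmul_bilin.1 _)).
rewrite (linear_rsum _ _ (bmul_bilin.2 _)).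
(* With the right-hand bracketing, g acts on a' (h.a''), so a'' receives gh. With the left-hand
   bracketing, h' acts on (g'.b) b', so b receives h'g'. These are the two sides of [rsum_shift]. *)
transitivity (rsum th (fun h h' => rsum th (fun g g' =>
  (a * gact D g a' * gact D (g * h)%g a'') \tens
  (gact D g' b * gact D h' b' * b'')))).
  apply: eq_rsum => h h'; rewrite bmul_tens; apply: eq_rsum => g g'.
  by rewrite DM (tm_actM DP) !mulrA.
transitivity (rsum th (fun g g' => rsum th (fun h h' =>
  (a * gact D g a' * gact D h a'') \tens
  (gact D (h' * g')%g b * gact D h' b' * b'')))).
  rewrite rsumC (rsum_shift thP (fun g h g' h' => (a * gact D g a' * gact D h a'') \tens
    (gact D g' b * gact D h' b' * b''))) //.
apply: eq_rsum => h h'; rewrite bmul_tens; apply: eq_rsum => g g'.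
by rewrite DM (tm_actM DP).
Qed.

End BraidedProduct.
End ThetaMorphisms.

(** * Bilinear associative unital products as algebras *)

Section AlgebraOfProduct.
Variables (K : fieldType) (V : vectType K) (m : V -> V -> V) (e : V).
Hypotheses (mB : bilin m) (mA : associative m) (m1l : left_id e m)
  (m1r : right_id e m) (e0 : e != 0).

(** The axioms are arguments of the alias, so that the instances declared on it can use them and no
    ring structure is attached to [V] itself. *)
Definition prod_alg of bilin m & associative m & left_id e m & right_id e m & e != 0 : Type := V.
Local Notation T := (prod_alg mB mA m1l m1r e0).

HB.instance Definition _ := Vector.copy T V.

Let mDl : left_distributive m +%R.
Proof. by move=> a b c; rewrite (linear_propD (mB.2 c)). Qed.
Let mDr : right_distributive m +%R.
Proof. by move=> a b c; rewrite (linear_propD (mB.1 a)). Qed.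

HB.instance Definition _ := GRing.Zmodule_isNzRing.Build T mA m1l m1r mDl mDr e0.

Let mZl (k : K) (a b : T) : k *: (a * b) = k *: a * b.
Proof. by symmetry; apply: (linear_propZ (mB.2 b)). Qed.
HB.instance Definition _ := GRing.Lmodule_isLalgebra.Build K T mZl.
Let mZr (k : K) (a b : T) : k *: (a * b) = a * (k *: b).
Proof. by symmetry; apply: (linear_propZ (mB.1 a)). Qed.
HB.instance Definition _ := GRing.Lalgebra_isAlgebra.Build K T mZr.
HB.instance Definition _ := Algebra_isFalgebra.Build K T.

(** The existential hides the carrier and leaves only the transport maps. It is applied to the pairs
    a + b y that model A, and later to the braided tensor square. *)
Lemma alg_of_product : exists (B : falgType K) (h : B -> V) (h' : V -> B),
  [/\ linear h /\ linear h', cancel h h', cancel h' h, h 1 = e &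
      forall a b, h (a * b) = m (h a) (h b)].
Proof. by exists T, id, id; split. Qed.

End AlgebraOfProduct.

(** * The algebras with the given presentations *)

Lemma vect_bij_dim (K : fieldType) (U V : vectType K) (f : U -> V) (g : V -> U) :
  linear f -> linear g -> cancel f g -> cancel g f ->
  \dim {:U} = \dim {:V}.
Proof.
have le_dim (U' V' : vectType K) (f' : U' -> V') : linear f' -> injective f' ->
    (\dim {:U'} <= \dim {:V'})%N.
  move=> lf' inj_f'.
  pose h : {linear U' -> V'} := HB.pack f' (GRing.isLinear.Build K U' V' *:%R f' lf').
  have k0 : lker (linfun h) == 0%VS by apply/lker0P => a b; rewrite !lfunE => /inj_f'.
  rewrite -(limg_dim_eq (f := linfun h) (U := fullv)); last by rewrite (eqP k0) capv0.
  exact/dimvS/subvf.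
move=> lf lg fK gK; apply/eqP; rewrite eqn_leq (le_dim _ _ f) ?(le_dim _ _ g) //.
  exact: can_inj gK.
exact: can_inj fK.
Qed.

Lemma alg_hom_comp (K : fieldType) (A B C : algType K) (f : B -> C) (g : A -> B) :
  alg_hom f -> alg_hom g -> alg_hom (f \o g).
Proof.
move=> [lf f1 fM] [lg g1 gM]; split; first exact: linear_comp.
  by rewrite /= g1.
by move=> a b /=; rewrite gM fM.
Qed.

Lemma alg_hom_id (K : fieldType) (A : algType K) : alg_hom (@id A).
Proof. by split=> // a u v. Qed.

Lemma alg_homX (K : fieldType) (A B : algType K) (f : A -> B) a n :
  alg_hom f -> f (a ^+ n) = f a ^+ n.
Proof.
by case=> lf f1 fM; elim: n => [|n IHn]; rewrite ?expr0 // !exprS fM IHn.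
Qed.

Section CyclicEvaluation.
Variable K : fieldType.
Local Notation Z4 := ('Z_4 : finGroupType).
Local Notation R := (groupAlg K Z4).

Definition cyc_eval (B : algType K) (u : B) (a : R) : B :=
  \sum_(k : 'Z_4) (a k : K) *: u ^+ k.

Lemma cyc_eval_linear (B : algType K) (u : B) : linear (cyc_eval u).
Proof. exact: (@linear_coefs K Z4). Qed.

Lemma cyc_eval_gelt (B : algType K) (u : B) (k : 'Z_4) :
  cyc_eval u (gelt K (k : Z4)) = u ^+ k.
Proof. exact: (@sum_gelt K Z4). Qed.

Lemma cyc_eval_hom (B : algType K) (u : B) : u ^+ 4 = 1 -> alg_hom (cyc_eval u).
Proof.
move=> u4; split; [exact: cyc_eval_linear | exact: (cyc_eval_gelt _ 0) |].
have lE := @cyc_eval_linear B u.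
move=> a b; move: a; apply: (@groupAlg_ext K Z4) => [k x z|k x z|g].
- by rewrite mulrDl -scalerAl lE.
- by rewrite lE mulrDl scalerAl.
move: b; apply: (@groupAlg_ext K Z4) => [k x z|k x z|h].
- by rewrite mulrDr -scalerAr lE.
- by rewrite lE mulrDr scalerAr.
by rewrite -geltM !cyc_eval_gelt -exprD -(expr_mod (g + h) u4).
Qed.

Lemma cycAlgC (a b : R) : a * b = b * a.
Proof.
move: a; apply: (@groupAlg_ext K Z4) => [k x z|k x z|g].
- by rewrite mulrDl -scalerAl.
- by rewrite mulrDr -scalerAr.
move: b; apply: (@groupAlg_ext K Z4) => [k x z|k x z|h].
- by rewrite mulrDr -scalerAr.
- by rewrite mulrDl -scalerAl.
by rewrite -!geltM; congr (gelt K _); apply: addrC.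
Qed.

Definition cyc_gen : R := gelt K (1%R : 'Z_4).

Lemma cyc_genXn n : cyc_gen ^+ n = gelt K (n%:R : 'Z_4).
Proof.
elim: n => [|n IHn]; first by [].
by rewrite exprS IHn -geltM; congr (gelt K _); rewrite -natr1 addrC.
Qed.

Lemma cyc_genX (k : 'Z_4) : cyc_gen ^+ k = gelt K (k : Z4).
Proof. by rewrite cyc_genXn natr_Zp. Qed.

Lemma cyc_gen4 : cyc_gen ^+ 4 = 1.
Proof. by rewrite cyc_genXn; congr (gelt K _); apply/val_inj. Qed.

End CyclicEvaluation.

Section Presentation.
Variables (K : fieldType) (t : alg_kind) (zeta : K).
(* the exponent e with y x = x^e y *)
Definition twist : nat := if t is TypeI then 1 else 3.

Definition ysquare (B : algType K) (x : B) : B :=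
  match t with
  | TypeI => 2^-1 *: (1 + zeta *: x + x ^+ 2 - zeta *: x ^+ 3)
  | TypeII => 2^-1 *: (zeta *: 1 + x - zeta *: x ^+ 2 + x ^+ 3)
  end.

(** As 3 * 3 is 1 modulo 4, the relation x y = y x^3 can be turned round to y x = x^3 y. Both types
    then share the form y x = x^e y, suited to normal forms with y on the right. *)
Lemma relations_twist (B : algType K) (x y : B) :
  relations t zeta x y <-> [/\ x ^+ 4 = 1, y * x = x ^+ twist * y & y ^+ 2 = ysquare x].
Proof.
rewrite /relations /twist /ysquare; case: t; split=> -[].
- by move=> xy x4 y2; split; rewrite ?expr1.
- by move=> x4 xy y2; split; rewrite ?xy ?expr1.
- move=> x4 xy y2; split=> //.
  have -> : y * x = y * x ^+ 9 by rewrite -(expr_mod 9 x4).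
  have xX n : x ^+ n * y = y * x ^+ (3 * n).
    elim: n => [|n IHn]; first by rewrite mul1r mulr1.
    by rewrite exprSr -mulrA xy mulrA IHn -mulrA -exprD mulnS addnC.
  by rewrite xX.
- move=> x4 yx y2; split=> //.
  have yX n : y * x ^+ n = x ^+ (3 * n) * y.
    elim: n => [|n IHn]; first by rewrite mul1r mulr1.
    by rewrite exprS mulrA yx -mulrA IHn mulrA -exprD mulnS.
  by rewrite yX -(expr_mod 9 x4).
Qed.

Lemma alg_hom_ysquare (B C : algType K) (f : B -> C) x : alg_hom f -> f (ysquare x) = ysquare (f x).
Proof.
move=> fH; have [lf f1 _] := fH.
rewrite /ysquare; case: t; rewrite !(linear_propZ lf) !(linear_propD lf)
  !(linear_propN lf) ?(linear_propZ lf) !(alg_homX _ _ fH)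
  ?f1 ?(linear_propD lf) ?(linear_propZ lf) //.
Qed.

End Presentation.

Section QuadraticExtension.
Variables (K : fieldType) (R : falgType K) (s : R -> R) (u : R).
Hypotheses (RC : forall a b : R, a * b = b * a) (sH : alg_hom s)
  (sK : involutive s) (su : s u = u).

(* (a, b) stands for a + b y with y a = s(a) y and y^2 = u *)
Definition ext_mul (p q : R * R) : R * R :=
  (p.1 * q.1 + p.2 * s q.2 * u, p.1 * q.2 + p.2 * s q.1).

Lemma ext_mul_bilin : bilin ext_mul.
Proof.
have [sD _ _] := sH.
split=> -[a b] k [c d] [c' d']; congr (_, _) => /=; rewrite ?sD;
  rewrite ?(mulrDl, mulrDr) -?(scalerAl, scalerAr) -?(scalerAl, scalerAr);
  by rewrite scalerDr addrACA.
Qed.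

Lemma ext_mulA : associative ext_mul.
Proof.
pose R' : comNzRingType := HB.pack (Falgebra.sort R)
  (GRing.PzRing_hasCommutativeMul.Build R RC).
(* Once [s] has been distributed, s(s(f)) = f and s(u) = u leave polynomial identities in which
   s(c), s(d), s(e), s(f) may be treated as independent commuting variables. *)
have E1 (a b c d e f v c' d' e' f' : R') :
  a * (c * e + d * f' * v) + b * (c' * f' + d' * e) * v =
  (a * c + b * d' * v) * e + (a * d + b * c') * f' * v by ring.
have E2 (a b c d e f v c' d' e' f': R') :
  a * (c * f + d * e') + b * (c' * e' + d' * f * v) =
  (a * c + b * d' * v) * f + (a * d + b * c') * e' by ring.
have [sD s1 sM] := sH; have sD' := linear_propD sD.
case=> [a b] [c d] [e f]; congr (_, _) => /=; rewrite !(sD', sM) !sK ?su.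
  exact: (E1 a b c d e f u (s c) (s d) (s e) (s f)).
exact: (E2 a b c d e f u (s c) (s d) (s e) (s f)).
Qed.

Lemma ext_mul1l : left_id (1, 0) ext_mul.
Proof. by case=> a b; rewrite /ext_mul /= !mul0r !mul1r !addr0. Qed.

Lemma ext_mul1r : right_id (1, 0) ext_mul.
Proof.
have [sD s1 sM] := sH.
by case=> a b; rewrite /ext_mul /= s1 (linear_prop0 sD) !mulr0 mul0r !mulr1 addr0 add0r.
Qed.

Lemma ext_one_neq0 : ((1, 0) : R * R) != 0.
Proof. by rewrite xpair_eqE oner_eq0. Qed.

Definition ext_alg :=
  alg_of_product ext_mul_bilin ext_mulA ext_mul1l ext_mul1r ext_one_neq0.

End QuadraticExtension.

Section PresentedAlgebra.
Variables (K : fieldType) (t : alg_kind) (zeta : K).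
(* R stands for K[x]/(x^4 - 1), with its universal property; keeping it abstract
   prevents the unifier from unfolding the convolution product *)
Variables (R : falgType K) (X : R) (ev : forall B : algType K, B -> R -> B).
Hypotheses (dimR : \dim {:R} = 4%N) (RC : forall a b : R, a * b = b * a) (X4 : X ^+ 4 = 1).
Hypothesis R_ext : forall (V : lmodType K) (F G : R -> V), linear F -> linear G ->
  (forall n, F (X ^+ n) = G (X ^+ n)) -> F =1 G.
Hypothesis ev_linear : forall (B : algType K) (u : B), linear (ev u).
Hypothesis ev_hom : forall (B : algType K) (u : B), u ^+ 4 = 1 -> alg_hom (ev u).
Hypothesis evX : forall (B : algType K) (u : B), ev u X = u.

Local Notation e := (twist t).
Local Notation u0 := (ysquare t zeta X).
Local Notation s := (ev (X ^+ e)).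

Lemma ev_Xn (B : algType K) (u : B) n : u ^+ 4 = 1 -> ev u (X ^+ n) = u ^+ n.
Proof. by move=> u4; rewrite (alg_homX _ _ (ev_hom u4)) evX. Qed.

Lemma Xe4 : (X ^+ e) ^+ 4 = 1.
Proof. by rewrite exprAC X4 expr1n. Qed.

Lemma s_hom : alg_hom s.
Proof. exact: ev_hom Xe4. Qed.

Lemma ev_twist (B : algType K) (u : B) a : u ^+ 4 = 1 -> ev u (s a) = ev (u ^+ e) a.
Proof.
move=> u4; move: a; apply: R_ext => [||n].
- exact: linear_comp (@ev_linear _ _) (@ev_linear _ _).
- exact: ev_linear.
have ue4 : (u ^+ e) ^+ 4 = 1 by rewrite exprAC u4 expr1n.
by rewrite !ev_Xn ?Xe4 // -!exprM ev_Xn.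
Qed.

Lemma sK : involutive s.
Proof.
move=> a; rewrite ev_twist ?Xe4 // -exprM; have -> : X ^+ (e * e) = X.
  by rewrite /twist; case: t => //; rewrite -(expr_mod (3 * 3) X4).
move: a; apply: R_ext => [|k a b|n] //; [exact: ev_linear | by rewrite ev_Xn].
Qed.

(** For type II, [s] exchanges X and X^3 and fixes 1 and X^2; the two exchanged powers have the same
    coefficient in [u0]. For type I, [s] fixes X. *)
Lemma s_ysquare : s u0 = u0.
Proof.
rewrite (alg_hom_ysquare _ _ _ s_hom) evX /twist /ysquare; case: t => //.
rewrite -!exprM -(expr_mod (3 * 2) X4) -(expr_mod (3 * 3) X4) /=.
by congr (_ *: _); rewrite [LHS]addrAC (addrAC (zeta *: 1)) [LHS]addrAC.
Qed.

Definition cyc_ext (B : algType K) (x y : B) (p : R * R) : B :=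
  ev x p.1 + ev x p.2 * y.

Lemma cyc_ext_linear (B : algType K) (x y : B) : linear (cyc_ext x y).
Proof.
move=> k p q; rewrite /cyc_ext !ev_linear mulrDl -scalerAl scalerDr.
by rewrite addrACA.
Qed.

(** Moving y to the right past a(x) replaces a by s(a), so products in [B] have the same normal form
    as in the model. This yields the existence half of the universal property. *)
Lemma cyc_extM (B : algType K) (x y : B) p q : relations t zeta x y ->
  cyc_ext x y (ext_mul s u0 p q) = cyc_ext x y p * cyc_ext x y q.
Proof.
case/relations_twist => x4 yx y2.
have [fD f1 fM] := ev_hom x4; have fD' := linear_propD fD.
have xe4 : (x ^+ e) ^+ 4 = 1 by rewrite exprAC x4 expr1n.
have yf a : y * ev x a = ev x (s a) * y.
  move: a; apply: R_ext => [k a b|k a b|k].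
  - by rewrite fD mulrDr -scalerAr.
  - by rewrite !ev_twist // ev_linear mulrDl -scalerAl.
  - rewrite ev_twist // !ev_Xn //; elim: (k : nat) => [|n IHn].
      by rewrite mul1r mulr1.
    by rewrite exprS mulrA yx -mulrA IHn mulrA -exprS.
case: p q => [a b] [c d]; rewrite /cyc_ext /ext_mul /= !fD' !fM.
rewrite (alg_hom_ysquare _ _ _ (ev_hom x4)) evX -y2.
rewrite mulrDr !mulrDl -!mulrA !yf [y * (_ * y)]mulrA yf expr2 -!mulrA -!addrA.
by congr (_ + _); rewrite [LHS]addrC -addrA [LHS]addrCA.
Qed.

Lemma cyc_ext_cyc (B : algType K) (x y : B) a : cyc_ext x y (a, 0) = ev x a.
Proof. by rewrite /cyc_ext /= (linear_prop0 (@ev_linear _ x)) mul0r addr0. Qed.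

(** The generators are the pairs (X, 0) and (0, 1). Uniqueness of homomorphisms holds because (a, b)
    = (a, 0) + (b, 0)(0, 1) and (a, 0) is a polynomial in (X, 0). *)
Lemma exists_presented : exists (A : falgType K) (x y : A) (h : R * R -> A) (h' : A -> R * R),
  [/\ presented t zeta x y, linear h /\ linear h', cancel h h', cancel h' h & h =1 cyc_ext x y].
Proof.
have [B [h' [h [[lh' lh] h'K hK h'1 h'M]]]] := ext_alg RC s_hom sK s_ysquare.
have hM p q : h (ext_mul s u0 p q) = h p * h q.
  by apply: (can_inj h'K); rewrite h'M !hK.
have h1 : h (1, 0) = 1 by rewrite -h'1 h'K.
have [sD s1 sM] := s_hom; have s0 := linear_prop0 sD.
have hX a b : h (a * b, 0) = h (a, 0) * h (b, 0).
  by rewrite -hM /ext_mul /= s0 !(mulr0, mul0r) !addr0.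
have hXn n : h (X ^+ n, 0) = h (X, 0) ^+ n.
  by elim: n => [|n IHn]; rewrite ?expr0 // !exprS hX IHn.
have hY a b : h (a, b) = h (a, 0) + h (b, 0) * h (0, 1).
  rewrite -hM -(linear_propD lh) /ext_mul; congr (h (_, _)) => /=;
  by rewrite ?s0 ?mulr0 ?mulr1 ?mul0r ?addr0 ?add0r.
have hE a : h (a, 0) = ev (h (X, 0)) a.
  move: a; apply: R_ext => [k a b||k].
  - rewrite -lh; congr (h (_, _)) => /=; by rewrite scaler0 addr0.
  - exact: ev_linear.
  - by rewrite ev_Xn ?hXn // -hXn X4.
have rXY : relations t zeta (h (X, 0)) (h (0, 1)).
  have x4 : h (X, 0) ^+ 4 = 1 by rewrite -hXn X4.
  apply/relations_twist; split => //.
  - rewrite -hXn -(hM (0, 1) (X, 0)) -(hM (X ^+ _, 0) (0, 1)) /ext_mul /= s0.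
    have -> : s X = X ^+ twist t.
      by rewrite evX.
    by rewrite !(mul0r, mulr0, mul1r, mulr1, addr0, add0r).
  - rewrite expr2 -hM /ext_mul /= s0 s1 !mul0r !mulr0 !mul1r addr0 add0r hE.
    rewrite (alg_hom_ysquare _ _ _ (ev_hom x4)).
    by rewrite evX.
exists B, (h (X, 0)), (h (0, 1)), h, h'; split.
2: by split.
2: exact: hK.
2: exact: h'K.
2: by case=> a b; rewrite hY (hE a) (hE b).
split; [exact: rXY | move=> C u v ruv; split].
  exists (cyc_ext u v \o h'); split.
  - split; first exact: linear_comp (cyc_ext_linear _ _) lh'.
      rewrite /= h'1 cyc_ext_cyc; by case/relations_twist: ruv => /ev_hom [].
    by move=> a b /=; rewrite h'M cyc_extM.
  - by case/relations_twist: ruv => u4 _ _; rewrite /= hK cyc_ext_cyc evX.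
  - rewrite /= hK /cyc_ext /= (linear_prop0 (@ev_linear _ u)) add0r.
    by case/relations_twist: ruv => /ev_hom [_ -> _] _ _; rewrite mul1r.
move=> f g fH gH fgX fgY b; rewrite -[b]h'K; case: (h' b) => {b} a b.
have [lf f1 fM] := fH; have [lg g1' gM] := gH.
have E a' : f (h (a', 0)) = g (h (a', 0)).
  rewrite hE; move: a'; apply: R_ext => [||k].
  - exact: linear_comp lf (@ev_linear _ _).
  - exact: linear_comp lg (@ev_linear _ _).
  - by rewrite ev_Xn ?(alg_homX _ _ fH) ?(alg_homX _ _ gH) ?fgX // -hXn X4.
by rewrite hY (linear_propD lf) (linear_propD lg) fM gM !E fgY.
Qed.

(** Algebras with the same presentation are isomorphic, since both composites fix the generators.
    Hence the dimension and the normal form pass from the model to every presented [A]. *)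
Lemma presented_cyc_ext (A : falgType K) (x y : A) : presented t zeta x y ->
  \dim {:A} = 8%N /\ forall a, exists p, a = cyc_ext x y p.
Proof.
move=> [rA uA]; have [B [x' [y' [h [h' [[rB uB] [lh lh'] hK h'K hE]]]]]] := exists_presented.
have [[f [fH fx fy]] _] := uA _ _ _ rB.
have [[g [gH gx gy]] _] := uB _ _ _ rA.
have [lf f1 fM] := fH; have [lg g1' gM] := gH.
have fK : cancel f g.
  apply: ((uA _ _ _ rA).2 (g \o f) id (alg_hom_comp gH fH) (alg_hom_id _)).
    by rewrite /= fx gx.
  by rewrite /= fy gy.
have gK : cancel g f.
  apply: ((uB _ _ _ rB).2 (f \o g) id (alg_hom_comp fH gH) (alg_hom_id _)).
    by rewrite /= gx fx.
  by rewrite /= gy fy.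
split.
  rewrite (vect_bij_dim lf lg fK gK) -(vect_bij_dim lh lh' hK h'K).
  by have := dimR; rewrite !dimvf {2}/dim /= => ->.
move=> a; exists (h' (f a)).
have gE p : g (cyc_ext x' y' p) = cyc_ext x y p.
  rewrite /cyc_ext (linear_propD lg) gM gy.
  have x4 : x ^+ 4 = 1 by case/relations_twist: rA.
  have x'4 : x' ^+ 4 = 1 by case/relations_twist: rB.
  have E c : g (ev x' c) = ev x c.
    move: c; apply: R_ext => [||n]; [|exact: ev_linear|].
      exact: linear_comp lg (@ev_linear _ _).
    by rewrite !ev_Xn // (alg_homX _ _ gH) gx.
  by rewrite !E.
by rewrite -gE -hE h'K fK.
Qed.

End PresentedAlgebra.

Section PresentedExistence.
Variables (K : fieldType) (t : alg_kind) (zeta : K).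
Local Notation Z4 := ('Z_4 : finGroupType).

HB.instance Definition _ (gT : finGroupType) :=
  Algebra_isFalgebra.Build K (groupAlg K gT).

(** K[x]/(x^4 - 1) is realized as the group ring of the cyclic group of order 4, with x the
    generator. *)
Let R : falgType K := groupAlg K Z4.

Let dimR : \dim {:R} = 4%N.
Proof. by rewrite dimvf /= /dim /= card_ord. Qed.

Let RC (a b : R) : a * b = b * a.
Proof. exact: cycAlgC. Qed.

Let X4 : (cyc_gen K : R) ^+ 4 = 1.
Proof. exact: cyc_gen4. Qed.

Let R_ext (V : lmodType K) (F G : R -> V) : linear F -> linear G ->
  (forall n, F ((cyc_gen K : R) ^+ n) = G ((cyc_gen K : R) ^+ n)) -> F =1 G.
Proof.
move=> lF lG FG; apply: (@groupAlg_ext K Z4) => // k.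
by have := FG k; rewrite [_ ^+ k](cyc_genX _ k).
Qed.

Let ev (B : algType K) (u : B) : R -> B := cyc_eval u.

Let ev_linear (B : algType K) (u : B) : linear (ev u).
Proof. exact: cyc_eval_linear. Qed.

Let ev_hom (B : algType K) (u : B) : u ^+ 4 = 1 -> alg_hom (ev u).
Proof. exact: cyc_eval_hom. Qed.

Let evX (B : algType K) (u : B) : ev u (cyc_gen K) = u.
Proof. by rewrite /ev /cyc_gen cyc_eval_gelt expr1. Qed.

Lemma presented_exists : exists (A : falgType K) (x y : A), presented t zeta x y.
Proof.
have [A [x [y [h [h' [P _ _ _ _]]]]]] := exists_presented t zeta RC X4 R_ext ev_linear ev_hom evX.
by exists A, x, y.
Qed.

Lemma presented_span (A : falgType K) (x y : A) : presented t zeta x y ->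
  \dim {:A} = 8%N /\ forall a, exists c d : 'I_4 -> K,
    a = \sum_i c i *: x ^+ i + (\sum_i d i *: x ^+ i) * y.
Proof.
move=> P; have [d8 sp] := presented_cyc_ext dimR RC X4 R_ext ev_linear ev_hom evX P.
by split=> // a; have [[c d] ->] := sp a; exists c, d.
Qed.

End PresentedExistence.

(** * Identities between linear combinations *)

Section ModuleReflection.
Variables (K : fieldType) (V : lmodType K).

(** Syntax for a reflective tactic: an identity between linear combinations follows if the
    coefficients of each atom agree, and those are scalar equations within reach of [field]. The
    atoms need not be linearly independent. *)
Inductive lexp := LZero | LVar of nat | LAdd of lexp & lexp | LOpp of lexp
  | LScale of K & lexp.

Fixpoint leval (env : seq V) (e : lexp) : V :=
  match e with
  | LZero => 0
  | LVar n => nth 0 env n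
  | LAdd e1 e2 => leval env e1 + leval env e2
  | LOpp e1 => - leval env e1
  | LScale k e1 => k *: leval env e1
  end.

Fixpoint lcoef (e : lexp) (n : nat) : K :=
  match e with
  | LZero => 0
  | LVar m => if eqn m n then 1 else 0
  | LAdd e1 e2 => lcoef e1 n + lcoef e2 n
  | LOpp e1 => - lcoef e1 n
  | LScale k e1 => k * lcoef e1 n
  end.

Fixpoint same_coefs (e1 e2 : lexp) (n : nat) : Prop :=
  if n is m.+1 then lcoef e1 m = lcoef e2 m /\ same_coefs e1 e2 m else True.

Lemma leval_coef env e : leval env e = \sum_(i < size env) lcoef e i *: env`_i.
Proof.
elim: e => [|n|e1 /= -> e2 ->|e /= ->|k e /= ->].
- by rewrite big1 // => i _; rewrite scale0r.
- have coefE i : lcoef (LVar n) i = (n == i)%:R by rewrite /= -[eqn n i]/(n == i); case: eqP.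
  under eq_bigr => i _ do rewrite coefE.
  case: (ltnP n (size env)) => [n_lt | n_ge] /=.
    rewrite (bigD1 (Ordinal n_lt)) //= eqxx scale1r big1 ?addr0 // => i.
    by rewrite -val_eqE eq_sym /= => /negPf->; rewrite scale0r.
  rewrite nth_default // big1 // => i _.
  by rewrite gtn_eqF ?scale0r // (leq_trans (ltn_ord i)).
- by rewrite -big_split; apply: eq_bigr => i _; rewrite scalerDl.
- by rewrite -sumrN; apply: eq_bigr => i _; rewrite scaleNr.
- by rewrite scaler_sumr; apply: eq_bigr => i _; rewrite scalerA.
Qed.

Lemma leval_eq env e1 e2 : same_coefs e1 e2 (size env) -> leval env e1 = leval env e2.
Proof.
rewrite !leval_coef; move: (size env) => n E; apply: eq_bigr => i _.
suff -> : lcoef e1 i = lcoef e2 i by [].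
elim: n i E => [[] //|n IHn] i [En E]; have := ltn_ord i.
rewrite ltnS leq_eqVlt => /orP[/eqP -> // | lt_in].
exact: IHn (Ordinal lt_in) E.
Qed.
End ModuleReflection.

(* syntactic comparison of atoms, up to the paths of structure coercions *)
Ltac same_atom a b :=
  lazymatch constr:((a, b)) with
  | (?c, ?c) => constr:(true)
  | (tens ?v ?w, tens ?v' ?w') =>
    lazymatch same_atom v v' with true => same_atom w w' | _ => constr:(false) end
  | (GRing.mul ?v ?w, GRing.mul ?v' ?w') =>
    lazymatch same_atom v v' with true => same_atom w w' | _ => constr:(false) end
  | (GRing.exp ?v ?n, GRing.exp ?v' ?n) => same_atom v v'
  | (GRing.one _, GRing.one _) => constr:(true)
  | _ => constr:(false)
  end.
Ltac lmem a l :=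
  lazymatch l with
  | nil => constr:(false)
  | ?b :: ?l' => lazymatch same_atom a b with true => constr:(true) | _ => lmem a l' end
  end.
Ltac lindex a l :=
  lazymatch l with
  | ?b :: ?l' => lazymatch same_atom a b with
      | true => constr:(0%N)
      | _ => let n := lindex a l' in constr:(S n)
      end
  end.
Ltac latoms e l :=
  lazymatch e with
  | (?a + ?b)%R => let l1 := latoms a l in latoms b l1
  | (- ?a)%R => latoms a l
  | (_ *: ?a)%R => latoms a l
  | (@GRing.zero _)%R => l
  | _ => let b := lmem e l in
         lazymatch b with true => l | false => constr:(e :: l) end
  end.
Ltac lreify K e l :=
  lazymatch e with
  | (?a + ?b)%R => let a1 := lreify K a l in let b1 := lreify K b l in
                   constr:(@LAdd K a1 b1)
  | (- ?a)%R => let a1 := lreify K a l in constr:(@LOpp K a1)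
  | (?k *: ?a)%R => let a1 := lreify K a l in constr:(@LScale K k a1)
  | (@GRing.zero _)%R => constr:(@LZero K)
  | _ => let n := lindex e l in constr:(@LVar K n)
  end.
(* reduces an equation between linear combinations over K to the equality of
   the coefficients of all atoms *)
Ltac module K :=
  lazymatch goal with
  | |- @eq ?T ?a ?b =>
    let l0 := latoms a (@nil T) in
    let l := latoms b l0 in
    let ea := lreify K a l in
    let eb := lreify K b l in
    refine (@leval_eq K _ l ea eb _); cbn [same_coefs lcoef size eqn Nat.eqb];
    repeat match goal with |- _ /\ _ => split | |- True => exact I end
  end.


Lemma nz4 (K : fieldType) : (2 : K) != 0 -> (4 : K) != 0.
Proof. by move=> nz2; rewrite (natrM _ 2 2) mulf_neq0. Qed.

(** Decides the scalar equations modulo iota^2 = -1 and zeta^4 = 1; the denominators that remain are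
    2 and 4. *)
Ltac coef_field :=
  match goal with
  | n2 : is_true (2 != 0), i2 : _ ^+ 2 = -1, z4 : _ ^+ 4 = 1 |- _ =>
    (field: z4 i2); rewrite ?n2 ?(nz4 n2) //
  end.

(** * Group-like elements of the examples *)

Section G22Theory.

Lemma sumG22 (V : zmodType) (F : G22 -> V) :
  \sum_g F g = F g1 + F g2 + F g3 + F g4.
Proof.
rewrite (bigD1 g1) //= (bigD1 g2) //= (bigD1 g3) //= (bigD1 g4) //=.
rewrite big1 ?addr0 ?addrA // => g.
by move: g; apply: G22_cases; rewrite !eqxx ?andbF.
Qed.

Lemma cardG22 : #|G22| = 4%N.
Proof. by rewrite card_prod !card_ord. Qed.

Variables (K : fieldType) (zeta : K).
Hypotheses (nz2 : (2 : K) != 0) (zeta4 : zeta ^+ 4 = 1).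

Lemma thetaE :
  ((theta zeta g1 g1 = 1) * (theta zeta g1 g2 = 1) *
    (theta zeta g1 g3 = 1) * (theta zeta g1 g4 = 1)) *
  ((theta zeta g2 g1 = 1) * (theta zeta g2 g2 = zeta ^+ 2) *
    (theta zeta g2 g3 = -1) * (theta zeta g2 g4 = - zeta ^+ 2)) *
  ((theta zeta g3 g1 = 1) * (theta zeta g3 g2 = -1) *
    (theta zeta g3 g3 = 1) * (theta zeta g3 g4 = -1)) *
  ((theta zeta g4 g1 = 1) * (theta zeta g4 g2 = - zeta ^+ 2) *
    (theta zeta g4 g3 = -1) * (theta zeta g4 g4 = zeta ^+ 2)).
Proof.
repeat match goal with |- (_ * _)%type => split end; rewrite /theta;
match goal with |- _ ^+ ?m * _ ^+ ?n = _ =>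
  let m' := eval vm_compute in m in let n' := eval vm_compute in n in
  rewrite -[m]/m' -[n]/n' end; ring.
Qed.

Lemma theta_bicharacter : bicharacter (theta zeta).
Proof.
have [thM thC _ _] := (theta_spec zeta4 (theta zeta)).2 (fun _ _ => erefl).
have suml : forall h, \sum_g theta zeta g h = (#|G22| * (h == 1%g))%:R.
  rewrite cardG22; apply: G22_cases; rewrite sumG22 !thetaE.
  - by rewrite [g1 == 1%g]isT muln1; ring.
  - by rewrite (_ : (g2 == 1%g) = false) // muln0; ring.
  - by rewrite (_ : (g3 == 1%g) = false) // muln0; ring.
  - by rewrite (_ : (g4 == 1%g) = false) // muln0; ring.
split=> // [g h h'|g|g h|].
- by rewrite !(thC g) thM.
- by rewrite -suml; apply: eq_bigr => h _; rewrite thC.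
- by move: g h; apply: G22_cases; apply: G22_cases; rewrite !G22_mulE.
- by rewrite cardG22 nz4.
Qed.

End G22Theory.

Section Grouplikes.
Variables (K : fieldType) (gT : finGroupType) (A : falgType K) (D : ydhopf gT A).
Hypotheses (comulL : linear (comul D)) (counitL : linear (counit D)).

(** If c_i are the coordinates of [a], comparing Delta(a) with a (x) a gives c_i c_j = 0 for
    distinct i, j and c_i^2 = c_i. As eps(a) = 1, some c_i is nonzero, hence 1, and all others
    vanish. So a basis of group-like elements contains every group-like element. *)
Lemma grouplike_in_basis n (X : n.-tuple A) a : basis_of fullv X ->
  (forall b, b \in X -> grouplike D b) -> grouplike D a -> a \in X.
Proof.
move=> Xb XG [aD ae].
have fX := basis_free Xb.
have XkX (k : 'I_n) : X`_k \in X by rewrite -tnth_nth mem_tnth.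
have XkG (k : 'I_n) : grouplike D X`_k := XG _ (XkX k).
have aE : a = \sum_i coord X i a *: X`_i by apply: coord_basis (memvf a).
pose c i j (t : A \ox A) : K^o := tlift (fun v w : A => coord X i v * coord X j w : K^o) t.
have cL i j : linear (c i j) by exact: tlift_linear.
have cB i j : bilin (fun v w : A => coord X i v * coord X j w : K^o).
  split=> [v k w w' | w k v v']; rewrite linearP ?mulrDr ?mulrDl; congr (_ + _).
    exact: mulrCA.
  exact/esym/mulrA.
have cT i j v w : c i j (v \tens w) = coord X i v * coord X j w by rewrite /c tlift_tens.
have DE : comul D a = \sum_i coord X i a *: (X`_i \tens X`_i).
  rewrite {1}aE (linear_prop_sum comulL); apply: eq_bigr => k _.
  by rewrite (linear_propZ comulL); have [-> _] := XkG k.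
have cE i j : coord X i a * coord X j a = (i == j)%:R * coord X i a.
  rewrite -[LHS]cT -aD DE (linear_prop_sum (cL i j)).
  under eq_bigr do rewrite (linear_propZ (cL i j)) cT !coord_free //.
  rewrite (bigD1 i) //= big1 => [|k /negPf ki].
    by rewrite eqxx mul1r addr0 [LHS]mulrC eq_sym.
  by rewrite ki mul0r [LHS]mulr0.
have [i ci] : exists i, coord X i a != 0.
  apply/existsP; apply: contra_eqT ae => /existsPn a0.
  rewrite aE big1 ?(linear_prop0 counitL) 1?eq_sym ?oner_eq0 // => i _.
  by have := a0 i; rewrite negbK => /eqP ->; rewrite scale0r.
have ci1 : coord X i a = 1.
  by apply: (mulfI ci); rewrite cE eqxx mulr1 mul1r.
rewrite aE (bigD1 i) //= big1 => [|j ji]; first by rewrite ci1 scale1r addr0.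
have := cE i j; rewrite [i == j]eq_sym (negPf ji) mul0r ci1 mul1r => ->.
by rewrite scale0r.
Qed.

End Grouplikes.

Section ExampleAlgebra.
Variables (K : fieldType) (iota zeta : K) (t : alg_kind) (A : falgType K) (x y : A).
Hypotheses (nz2 : (2 : K) != 0) (iota2 : iota ^+ 2 = -1) (zeta4 : zeta ^+ 4 = 1).
Hypothesis xyP : presented t zeta x y.

Definition g22_case (T : Type) (a b c d : T) (g : G22) : T :=
  if g == g1 then a else if g == g2 then b else if g == g3 then c else d.

(** The indexing by G makes the structure visible: omega_g omega_h = omega_gh ([omM]), while [et] is
    a torsor, g.eta_h = eta_gh ([act_et]). *)
Definition om : G22 -> A :=
  g22_case (omega1 A) (omega2 iota zeta x) (omega3 iota zeta x) (omega4 x).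
Definition et : G22 -> A := g22_case (eta1 y) (eta2 x y) (eta3 x y) (eta4 x y).

Lemma relx4 : x ^+ 4 = 1.
Proof. by case: xyP => /relations_twist []. Qed.

Lemma relyy : y * y = match t with
  | TypeI => 2^-1 *: (1 + zeta *: x + x ^+ 2 - zeta *: x ^+ 3)
  | TypeII => 2^-1 *: (zeta *: 1 + x - zeta *: x ^+ 2 + x ^+ 3)
  end.
Proof. by case: xyP => /relations_twist [_ _]; rewrite expr2 => -> _; case: t. Qed.

Lemma xM : ((x * x = x ^+ 2) * (x * x ^+ 2 = x ^+ 3) * (x * x ^+ 3 = 1)) *
  ((x ^+ 2 * x = x ^+ 3) * (x ^+ 2 * x ^+ 2 = 1) * (x ^+ 2 * x ^+ 3 = x)) *
  ((x ^+ 3 * x = 1) * (x ^+ 3 * x ^+ 2 = x) * (x ^+ 3 * x ^+ 3 = x ^+ 2)).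
Proof.
have x4 := relx4.
by split; [split|]; (split; [split|]); rewrite -?exprS -?exprSr -?exprD // ?x4 //
  (exprD _ 4) x4 mul1r.
Qed.

Lemma yxn n : y * x ^+ n = x ^+ (twist t * n) * y.
Proof.
have [_ yx _] := (relations_twist t zeta x y).1 xyP.1.
elim: n => [|n IHn]; first by rewrite muln0 mul1r mulr1.
by rewrite exprS mulrA yx -mulrA IHn mulrA -exprD mulnS.
Qed.

Lemma yx2 : y * x ^+ 2 = x ^+ 2 * y.
Proof.
by rewrite yxn /twist; case: t => //; rewrite -(expr_mod (3 * 2) relx4).
Qed.

Lemma yx1 : y * x = (if t is TypeI then x else x ^+ 3) * y.
Proof. by rewrite -{1}[x]expr1 yxn /twist; case: t. Qed.

Lemma yx3 : y * x ^+ 3 = (if t is TypeI then x ^+ 3 else x) * y.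
Proof.
by rewrite yxn /twist; case: t => //; rewrite -(expr_mod (3 * 3) relx4).
Qed.

(** With c = iota zeta^2, the square of omega_2 has coefficient ((1 + c)^2 + (1 - c)^2)/4 = 0 at x^2
    and (1 - c^2)/2 = 1 at 1; the other products are similar. *)
Lemma omM g h : om g * om h = om (g * h)%g.
Proof.
move: g h; apply: G22_cases; apply: G22_cases; rewrite G22_mulE /om /g22_case /=;
  rewrite /omega1 ?mul1r ?mulr1 // /omega2 /omega3 /omega4;
  rewrite ?(mulrDl, mulrDr) -?(scalerAl, scalerAr) -?(scalerAl, scalerAr) ?xM //;
  module K; coef_field.
Qed.

Definition glikes : seq A := [seq om g | g <- [:: g1; g2; g3; g4]] ++
  [seq et g | g <- [:: g1; g2; g3; g4]].

Lemma x_om : x = (2^-1 * (1 - iota * zeta ^+ 2)) *: om g2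
               + (2^-1 * (1 + iota * zeta ^+ 2)) *: om g3.
Proof. by rewrite /om /g22_case /= /omega2 /omega3; module K; coef_field. Qed.

Lemma x3_om : x ^+ 3 = (2^-1 * (1 + iota * zeta ^+ 2)) *: om g2
               + (2^-1 * (1 - iota * zeta ^+ 2)) *: om g3.
Proof. by rewrite /om /g22_case /= /omega2 /omega3; module K; coef_field. Qed.

(** Eight elements in dimension 8 form a basis as soon as they span; [x_om] and [x3_om] recover the
    odd powers of x from omega_2 and omega_3. *)
Lemma glikes_basis : basis_of {:A} glikes.
Proof.
have [d8 sp] := presented_span xyP.
rewrite basisEdim d8 andbT; apply/subvP => a _.
have mg g : g \in [:: g1; g2; g3; g4] by move: g; apply: G22_cases.
have omV g : om g \in <<glikes>>%VS.
  by apply: memv_span; rewrite mem_cat map_f.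
have etV g : et g \in <<glikes>>%VS.
  by apply: memv_span; rewrite mem_cat orbC map_f.
have [c [d ->]] := sp a; rewrite mulr_suml; apply: rpredD;
  apply: rpred_sum => -[[|[|[|[|//]]]] i4] _.
- by apply/rpredZ/(omV g1).
- by apply/rpredZ; rewrite /= expr1 x_om; apply/rpredD; apply/rpredZ.
- by apply/rpredZ/(omV g4).
- by apply/rpredZ; rewrite /= x3_om; apply/rpredD; apply/rpredZ.
- by rewrite -scalerAl mul1r; apply/rpredZ/(etV g1).
- by rewrite -scalerAl; apply/rpredZ/(etV g4).
- by rewrite -scalerAl; apply/rpredZ/(etV g3).
- by rewrite -scalerAl; apply/rpredZ/(etV g2).
Qed.

End ExampleAlgebra.

(** * Action and braided product *)

Section AlgHom.
Variables (K : fieldType) (A B : algType K) (f : A -> B).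
Hypothesis fH : alg_hom f.
Lemma alg_hom_lin : linear f. Proof. by case: fH. Qed.
Lemma alg_hom1 : f 1 = 1. Proof. by case: fH. Qed.
Lemma alg_homM a b : f (a * b) = f a * f b. Proof. by case: fH => _ _ ->. Qed.
End AlgHom.

Section ExampleAction.
Variables (K : fieldType) (iota zeta : K) (t : alg_kind) (A : falgType K) (x y : A).
Hypotheses (nz2 : (2 : K) != 0) (iota2 : iota ^+ 2 = -1) (zeta4 : zeta ^+ 4 = 1).
Hypothesis xyP : presented t zeta x y.
Variable D : ydhopf G22 A.
Hypotheses (actD : example_action x y D) (coactD : example_coaction zeta D).

Local Notation om := (om iota zeta x).
Local Notation et := (et x y).
Local Notation a := (gact D).
Let xM := xM xyP.

Lemma act_hom g : alg_hom (a g).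
Proof. by case: actD => _ H _ _ _; case: (H g). Qed.

Lemma act_lin g : linear (a g).
Proof. by case: (act_hom g). Qed.

Lemma act1g v : a 1%g v = v.
Proof. by case: actD => _ _ H _ _; apply: H. Qed.

Lemma act_x : (a g1 x = x) * (a g2 x = x ^+ 3) * (a g3 x = x) * (a g4 x = x ^+ 3).
Proof.
case: actD => _ _ H1 [H2 _ H3 _] H4.
by do !split=> //; [exact: H1 | rewrite /gact H4 /= H3 H2].
Qed.

Lemma act_x2 g : a g (x ^+ 2) = x ^+ 2.
Proof.
rewrite (alg_homX _ _ (act_hom g)).
by move: g; apply: G22_cases; rewrite act_x // expr2 xM.
Qed.

Lemma act_x3 : (a g1 (x ^+ 3) = x ^+ 3) * (a g2 (x ^+ 3) = x) *
  (a g3 (x ^+ 3) = x ^+ 3) * (a g4 (x ^+ 3) = x).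
Proof.
have E g : a g (x ^+ 3) = a g x * x ^+ 2.
  by rewrite exprS (alg_homM (act_hom g)) act_x2.
by do !split; rewrite E act_x xM.
Qed.

Lemma act_y g : a g y = et g.
Proof.
case: actD => _ _ H1 [_ H2 _ H3] H4; move: g.
apply: G22_cases => //; first exact: H1.
rewrite [LHS]H4 /= H3.
have E2 : a g2 y = x ^+ 3 * y by exact: H2.
rewrite [LHS](alg_homM (act_hom g2)) act_x2 E2 /et /g22_case /=.
by rewrite /eta4 mulrA xM.
Qed.

Lemma act_om g h : a g (om h) =
  om (if (g == g2) || (g == g4) then g22_case g1 g3 g2 g4 h else h).
Proof.
have [lg g11 _] := act_hom g; move: h; apply: G22_cases.
- by rewrite if_same /om /g22_case /= g11.
- rewrite /om /g22_case /= (linear_propD lg) !(linear_propZ lg).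
  by move: {lg g11} g; apply: G22_cases; rewrite act_x act_x3 //= addrC.
- rewrite /om /g22_case /= (linear_propD lg) !(linear_propZ lg).
  by move: {lg g11} g; apply: G22_cases; rewrite act_x act_x3 //= addrC.
- by rewrite if_same /om /g22_case /= act_x2.
Qed.

Lemma act_et g h : a g (et h) = et (g * h)%g.
Proof.
have M g' := alg_homM (act_hom g').
move: g h; apply: G22_cases; apply: G22_cases; rewrite G22_mulE /et /g22_case /=
  /eta2 /eta3 /eta4 ?(act_x2, act_x3, act_x, M) !act_y /et /g22_case /=
  /eta1 /eta2 /eta3 /eta4 ?mulrA ?xM //;
  by rewrite ?mul1r.
Qed.

Lemma presented_ext (f f' : A -> A) : alg_hom f -> alg_hom f' ->
  f x = f' x -> f y = f' y -> f =1 f'.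
Proof. by case: xyP => rA uA; case: (uA _ _ _ rA) => _; apply. Qed.

(** [example_action] prescribes the operators of the individual group elements. That they compose
    like G follows because both sides are algebra homomorphisms that agree on x and y. *)
Lemma act_mul g h v : a (g * h)%g v = a g (a h v).
Proof.
apply: (presented_ext (act_hom _) (alg_hom_comp (act_hom g) (act_hom h))) => {v} /=.
  move: g h; apply: G22_cases; apply: G22_cases; rewrite G22_mulE;
  by rewrite ?act_x ?act_x3 ?act_x.
by rewrite !act_y act_et.
Qed.

Lemma example_theta : theta_module (theta zeta) D.
Proof.
split; [by case: actD | exact: act1g | exact: act_mul |].
by move=> v; rewrite coactD /rsum cardG22.
Qed.

End ExampleAction.

(** * The relations of A in the braided tensor square *)

Section ExampleBraiding.
Variables (K : fieldType) (iota zeta : K) (t : alg_kind) (A : falgType K) (x y : A).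
Hypotheses (nz2 : (2 : K) != 0) (iota2 : iota ^+ 2 = -1) (zeta4 : zeta ^+ 4 = 1).
Hypothesis xyP : presented t zeta x y.
Variable D : ydhopf G22 A.
Hypotheses (actD : example_action x y D) (coactD : example_coaction zeta D).

Local Notation om := (om iota zeta x).
Local Notation et := (et x y).
Local Notation a := (gact D).
Let xM := xM xyP.
Let DP := example_theta xyP actD coactD.
Let thP := theta_bicharacter nz2 zeta4.

(** On such elements G acts through its quotient by {g_1, g_3}, so theta may be summed over
    cosets. *)
Definition core_elt (c : A) : Prop := a g3 c = c /\ a g4 c = a g2 c.

Lemma core_elt_x n : core_elt (x ^+ n).
Proof.
by split; rewrite !(alg_homX _ _ (act_hom actD _)) !(act_x actD).
Qed.

(** All coset sums of theta vanish except the one for the pair of trivial cosets, which cancels the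
    factor 1/4; the braiding thus disappears from the product. *)
Lemma bmul_core b c p q : core_elt b -> core_elt c ->
  bmul D (p \tens b) (c \tens q) = (p * c) \tens (b * q).
Proof.
move=> [b3 b4] [c3 c4]; rewrite (bmul_tens DP) /rsum cardG22 !sumG22 !thetaE.
rewrite !b3 !b4 !c3 !c4 -![a g1 _]/(a 1%g _) !(act1g actD).
by module K; coef_field.
Qed.

(** Only the leg acting on b is summed over cosets. This eliminates g_2 and g_4 on the other leg and
    leaves y and g_3.y = x^2 y, with b + g_2.b and b - g_2.b respectively. *)
Lemma bmul_core_y b p q : core_elt b ->
  bmul D (p \tens b) (y \tens q) = 2^-1 *:
    ((p * y) \tens (b * q) + (p * y) \tens (a g2 b * q)
     + (p * (x ^+ 2 * y)) \tens (b * q) - (p * (x ^+ 2 * y)) \tens (a g2 b * q)).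
Proof.
move=> [b3 b4]; rewrite (bmul_tens DP) /rsum cardG22 !sumG22 !thetaE.
rewrite !b3 !b4 -![a g1 _]/(a 1%g _) !(act1g actD) !(act_y xyP actD).
rewrite /et /g22_case /= /eta1 /eta2 /eta3 /eta4.
by module K; coef_field.
Qed.

Lemma bmul_y_core c p q : core_elt c ->
  bmul D (p \tens y) (c \tens q) = 2^-1 *:
    ((p * c) \tens (y * q) + (p * a g2 c) \tens (y * q)
     + (p * c) \tens (x ^+ 2 * y * q) - (p * a g2 c) \tens (x ^+ 2 * y * q)).
Proof.
move=> [c3 c4]; rewrite (bmul_tens DP) /rsum cardG22 !sumG22 !thetaE.
rewrite !c3 !c4 -![a g1 _]/(a 1%g _) !(act1g actD) !(act_y xyP actD).
rewrite /et /g22_case /= /eta1 /eta2 /eta3 /eta4.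
by module K; coef_field.
Qed.

Lemma bmulDl s s' r : bmul D (s + s') r = bmul D s r + bmul D s' r.
Proof. exact: linear_propD ((bmul_bilin D).2 r) s s'. Qed.
Lemma bmulDr s r r' : bmul D s (r + r') = bmul D s r + bmul D s r'.
Proof. exact: linear_propD ((bmul_bilin D).1 s) r r'. Qed.
Lemma bmulNl s r : bmul D (- s) r = - bmul D s r.
Proof. exact: linear_propN ((bmul_bilin D).2 r) s. Qed.
Lemma bmulNr s r : bmul D s (- r) = - bmul D s r.
Proof. exact: linear_propN ((bmul_bilin D).1 s) r. Qed.
Lemma bmulZl k s r : bmul D (k *: s) r = k *: bmul D s r.
Proof. exact: linear_propZ ((bmul_bilin D).2 r) k s. Qed.
Lemma bmulZr k s r : bmul D s (k *: r) = k *: bmul D s r.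
Proof. exact: linear_propZ ((bmul_bilin D).1 s) k r. Qed.

Definition bmulE := (bmulDl, bmulDr, bmulZl, bmulZr, bmulNl, bmulNr).

Local Notation X := (2^-1 *: (x \tens x + x \tens x ^+ 3 + x ^+ 3 \tens x
                           - x ^+ 3 \tens x ^+ 3)).

Let cx : core_elt x. Proof. by rewrite -[x]expr1; apply: core_elt_x. Qed.

Lemma comul_x2 : bmul D X X = x ^+ 2 \tens x ^+ 2.
Proof.
rewrite !bmulE !bmul_core ?xM; try exact: cx; try exact: core_elt_x.
by module K; coef_field.
Qed.

Lemma comul_x3 : bmul D (x ^+ 2 \tens x ^+ 2) X =
  2^-1 *: (x ^+ 3 \tens x ^+ 3 + x ^+ 3 \tens x + x \tens x ^+ 3 - x \tens x).
Proof.
rewrite !bmulE !bmul_core ?xM; try exact: cx; try exact: core_elt_x.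
by [].
Qed.

Lemma comul_x4 : bmul D (x ^+ 2 \tens x ^+ 2) (x ^+ 2 \tens x ^+ 2) = 1 \tens 1.
Proof. by rewrite bmul_core ?xM; try exact: core_elt_x. Qed.

Local Notation X3 := (2^-1 *: (x ^+ 3 \tens x ^+ 3 + x ^+ 3 \tens x
  + x \tens x ^+ 3 - x \tens x)).
Local Notation Y := (y \tens y).
Let a2x : a g2 x = x ^+ 3. Proof. by rewrite (act_x actD). Qed.
Let a2x3 : a g2 (x ^+ 3) = x. Proof. by rewrite (act_x3 xyP actD). Qed.

Lemma comul_xy : bmul D X Y = (x * y) \tens (x * y).
Proof.
rewrite !bmulE !bmul_core_y ?a2x ?a2x3 ?mulrA ?xM ?mul1r; try exact: cx; try exact: core_elt_x.
by module K; coef_field.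
Qed.

Lemma comul_x2y : bmul D (x ^+ 2 \tens x ^+ 2) Y = (x ^+ 2 * y) \tens (x ^+ 2 * y).
Proof.
rewrite bmul_core_y ?(act_x2 xyP actD) ?mulrA ?xM ?mul1r; try exact: core_elt_x.
by module K; coef_field.
Qed.

Lemma comul_x3y : bmul D X3 Y = (x ^+ 3 * y) \tens (x ^+ 3 * y).
Proof.
rewrite !bmulE !bmul_core_y ?a2x ?a2x3 ?mulrA ?xM ?mul1r; try exact: cx; try exact: core_elt_x.
by module K; coef_field.
Qed.

Lemma comul_yx : bmul D Y X =
  (x ^+ twist t * y) \tens (x ^+ twist t * y).
Proof.
rewrite !bmulE !bmul_y_core ?a2x ?a2x3; try exact: cx; try exact: core_elt_x.
rewrite -?[_ * y * _]mulrA !(yx1 xyP, yx3 xyP) /twist.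
case: t; rewrite ?mulrA ?xM ?mul1r ?expr1.
  by module K; coef_field.
by module K; coef_field.
Qed.

(** Each g.y is a power of x times y, so both tensor factors are powers of x times y^2, and the
    relation for y^2 turns the claim into an identity between polynomials in x. *)
Lemma comul_yy : bmul D Y Y = 2^-1 *:
  match t with
  | TypeI => 1 \tens 1 + zeta *: X + x ^+ 2 \tens x ^+ 2 - zeta *: X3
  | TypeII => zeta *: (1 \tens 1) + X - zeta *: (x ^+ 2 \tens x ^+ 2) + X3
  end.
Proof.
rewrite (bmul_tens DP) /rsum cardG22.
have -> : \sum_g \sum_g' theta zeta g g' *: ((y * a g y) \tens (a g' y * y)) =
    \sum_g (y * a g y) \tens (\sum_g' theta zeta g g' *: (a g' y * y)).
  apply: eq_bigr => g _; rewrite tens_sumr; apply: eq_bigr => g' _.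
  by rewrite tensZr.
rewrite !sumG22 !thetaE !(act_y xyP actD) /et /g22_case /= /eta1 /eta2 /eta3 /eta4.
rewrite !(mulrA y (x ^+ _)) (mulrA y x) (yx1 xyP) (yx2 xyP) (yx3 xyP) -!(mulrA _ y y).
have uE := relyy xyP; set u := y * y in uE *.
case: t uE => uE.
  (* The second tensor factor, already summed over g', has this shape for every g; only the values
     p, q, r, s of theta vary. *)
  have sumE (p q r s : K) : p *: u + q *: (x ^+ 3 * u) + r *: (x ^+ 2 * u) + s *: (x * u) =
      2^-1 *: ((p + r + zeta * q - zeta * s) *: 1 + (q + s + zeta * p - zeta * r) *: x
        + (p + r + zeta * s - zeta * q) *: x ^+ 2 + (q + s + zeta * r - zeta * p) *: x ^+ 3).
    by rewrite uE -!scalerAr !(mulrDr, mulrN) -!scalerAr ?xM ?mulr1; module K; coef_field.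
  rewrite !sumE uE -!scalerAr !(mulrDr, mulrN) -!scalerAr ?xM ?mulr1 !(tensDl, tensZl, tensNl).
  by rewrite !(tensDr, tensZr); module K; coef_field.
have sumE (p q r s : K) : p *: u + q *: (x ^+ 3 * u) + r *: (x ^+ 2 * u) + s *: (x * u) =
    2^-1 *: ((zeta * p - zeta * r + q + s) *: 1 + (zeta * s - zeta * q + p + r) *: x
      + (zeta * r - zeta * p + q + s) *: x ^+ 2 + (zeta * q - zeta * s + p + r) *: x ^+ 3).
  by rewrite uE -!scalerAr !(mulrDr, mulrN) -!scalerAr ?xM ?mulr1; module K; coef_field.
rewrite !sumE uE -!scalerAr !(mulrDr, mulrN) -!scalerAr ?xM ?mulr1 !(tensDl, tensZl, tensNl).
by rewrite !(tensDr, tensZr); module K; coef_field.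
Qed.

End ExampleBraiding.

(** * Existence of the structure *)

Lemma tens_neq0 (K : fieldType) (V W : vectType K) (v : V) (w : W) :
  v != 0 -> w != 0 -> v \tens w != 0.
Proof.
have nzP (U : vectType K) (u : U) : u != 0 -> exists i, v2r u 0 i != 0.
  move=> u0; apply/existsP; apply: contraR u0 => /existsPn u0.
  apply/eqP/v2r_inj; rewrite linear0; apply/rowP=> i; rewrite [RHS]mxE.
  by apply/eqP; have := u0 i; rewrite negbK.
move=> /nzP[i vi] /nzP[j wj]; apply/eqP => /matrixP/(_ i j); rewrite !mxE big_ord1 !mxE.
by apply/eqP/mulf_neq0.
Qed.

Lemma basis_linear_map (K : fieldType) (V W : vectType K) (bs : seq V) (f : seq W) :
  basis_of fullv bs -> size f = size bs ->
  exists F : V -> W, linear F /\ forall i, (i < size bs)%N -> F bs`_i = f`_i.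
Proof.
move=> bB sz; have bF := basis_free bB.
exists (fun v => \sum_(i < size bs) coord (in_tuple bs) i v *: f`_i); split.
  move=> k u v; rewrite scaler_sumr -big_split; apply: eq_bigr => i _.
  by rewrite linearP scalerDl scalerA.
move=> i i_lt; rewrite (bigD1 (Ordinal i_lt)) //= big1 => [|j ji].
  by rewrite (coord_free (Ordinal i_lt) (Ordinal i_lt)) // eqxx scale1r addr0.
rewrite (coord_free (Ordinal i_lt) j) //.
by rewrite eq_sym (negPf ji) scale0r.
Qed.

Section ExampleExistence.
Variables (K : fieldType) (iota zeta : K) (t : alg_kind) (A : falgType K) (x y : A).
Hypotheses (nz2 : (2 : K) != 0) (iota2 : iota ^+ 2 = -1) (zeta4 : zeta ^+ 4 = 1).
Hypothesis xyP : presented t zeta x y.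
Let xM := xM xyP.

Let presented_hom (B : algType K) (u v : B) : relations t zeta u v ->
  exists f : A -> B, [/\ alg_hom f, f x = u & f y = v].
Proof. by case: xyP => _ uA /uA []. Qed.

Lemma relations_phi2 : relations t zeta (x ^+ 3) (x ^+ 3 * y).
Proof.
have E2 : (x ^+ 3) ^+ 2 = x ^+ 2 by rewrite expr2 xM.
have E3 : (x ^+ 3) ^+ 3 = x by rewrite exprS E2 xM.
apply/relations_twist; split; first by rewrite exprAC (relx4 xyP) expr1n.
  by rewrite -mulrA (yx3 xyP) /twist; case: t; rewrite ?expr1 ?E3 ?mulrA ?xM.
rewrite expr2 mulrA -(mulrA _ y) (yx3 xyP) -!mulrA (relyy xyP) /ysquare.
rewrite E2 E3; case: t; rewrite !mulrA ?xM ?mul1r.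
  by rewrite -!scalerAr !(mulrDr, mulrN) -!scalerAr ?xM ?mulr1; module K; coef_field.
by module K; coef_field.
Qed.

Lemma relations_phi3 : relations t zeta x (x ^+ 2 * y).
Proof.
have [x4 yx y2] := (relations_twist t zeta x y).1 xyP.1.
apply/relations_twist; split => //.
  by rewrite -mulrA yx (mulrA (x ^+ 2)) (mulrA (x ^+ twist t)) -!exprD addnC.
by rewrite expr2 mulrA -(mulrA _ y) (yx2 xyP) mulrA xM mul1r -expr2 y2.
Qed.

Lemma relations_counit : relations t zeta (1 : (K^o : algType K)) 1.
Proof.
apply/relations_twist; rewrite !expr1n mulr1; split=> //.
rewrite /ysquare; case: t; rewrite ?expr1n /GRing.scale /=; field; exact: nz2.
Qed.

Lemma exists_action : exists D : ydhopf G22 A,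
  example_action x y D /\ example_coaction zeta D.
Proof.
have [f2 [h2 f2x f2y]] := presented_hom relations_phi2.
have [f3 [h3 f3x f3y]] := presented_hom relations_phi3.
have f2K : involutive f2.
  apply: (presented_ext xyP (alg_hom_comp h2 h2) (alg_hom_id _)) => /=.
    by rewrite f2x (alg_homX _ _ h2) f2x -exprM -(expr_mod 9 (relx4 xyP)).
  by rewrite f2y (alg_homM h2) (alg_homX _ _ h2) f2x f2y mulrA -exprM -exprD
    -(expr_mod (3 * 3 + 3) (relx4 xyP)) mul1r.
have f3K : involutive f3.
  apply: (presented_ext xyP (alg_hom_comp h3 h3) (alg_hom_id _)) => /=.
    by rewrite !f3x.
  by rewrite f3y (alg_homM h3) (alg_homX _ _ h3) f3x f3y mulrA xM mul1r.
pose phi := g22_case id f2 f3 (f2 \o f3).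
pose act (h : groupAlg K G22) (v : A) := \sum_g (h g : K) *: phi g v.
have actE g : act (gelt K g) =1 phi g by move=> v; rewrite /act (sum_gelt (fun g => phi g v)).
pose S : ydstr G22 A := YDStr act (fun b =>
    4^-1 *: \sum_g \sum_g' theta zeta g g' *: (gelt K g \tens act (gelt K g') b)).
have hphi : forall g, alg_hom (phi g) /\ bijective (phi g).
  apply: G22_cases; split.
  - exact: alg_hom_id.
  - by exists id.
  - exact: h2.
  - by exists f2.
  - exact: h3.
  - by exists f3.
  - exact: alg_hom_comp h2 h3.
  - by exists (f3 \o f2) => v /=; rewrite /phi /g22_case /= ?f2K ?f3K.
(* Coproduct, counit and antipode are placeholders: the braided product, needed to construct the
   coproduct, depends on action and coaction alone. *)
exists (YDHopf S (fun _ => 0) (fun _ => 0) id); split; last by [].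
split.
- split=> [h k u v | v k h h'] /=; last exact: linear_coefs.
  rewrite /act scaler_sumr -big_split; apply: eq_bigr => g _ /=.
  by rewrite (alg_hom_lin (hphi g).1) scalerDr !scalerA mulrC.
- move=> g /=; have [[l1 o1 m1] [p pK Kp]] := hphi g; split.
    by split=> [k u v | | u v]; rewrite !actE ?l1 ?o1 ?m1.
  by exists p => v; rewrite ?actE ?pK ?Kp.
- by move=> v; rewrite /= actE.
- by rewrite /= !actE.
- by move=> v; rewrite /= !actE.
Qed.

Local Notation X := (2^-1 *: (x \tens x + x \tens x ^+ 3 + x ^+ 3 \tens x
                           - x ^+ 3 \tens x ^+ 3)).

Lemma exists_comul (D : ydhopf G22 A) : example_action x y D -> example_coaction zeta D ->
  exists F : A -> A \ox A, [/\ linear F, F 1 = 1 \tens 1,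
    forall a b, F (a * b) = bmul D (F a) (F b), F x = X & F y = y \tens y].
Proof.
move=> actD coactD.
have thP := theta_bicharacter nz2 zeta4.
have DP := example_theta xyP actD coactD.
have g1h g := alg_hom1 (act_hom actD g).
have gMh g := alg_homM (act_hom actD g).
have one0 : (1 : A) \tens (1 : A) != 0 by apply: tens_neq0; apply: oner_neq0.
(* The braided tensor square becomes an algebra [B], to which the universal property of A applies;
   the relations are then checked through the injective map [h]. *)
have [B [h [h' [[lh lh'] hK h'K h1 hM]]]] := alg_of_product (bmul_bilin D)
  (bmulA thP DP gMh) (bmul1t thP DP g1h) (bmult1 thP DP g1h) one0.
have hI := can_inj hK.
have X2 : h (h' X ^+ 2) = x ^+ 2 \tens x ^+ 2.
  by rewrite expr2 hM !h'K (comul_x2 nz2 iota2 zeta4 xyP actD coactD).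
have X3 : h (h' X ^+ 3) = bmul D (x ^+ 2 \tens x ^+ 2) X by rewrite exprSr hM X2 h'K.
have rel : relations t zeta (h' X) (h' (y \tens y)).
  apply/relations_twist; split; apply: hI.
  - by rewrite (exprD _ 2 2) hM X2 h1 (comul_x4 nz2 iota2 zeta4 xyP actD coactD).
  - rewrite !hM !h'K (comul_yx nz2 iota2 zeta4 xyP actD coactD) /twist; case: t.
      by rewrite !expr1 h'K (comul_xy nz2 iota2 zeta4 xyP actD coactD).
    rewrite X3 (comul_x3 nz2 iota2 zeta4 xyP actD coactD).
    by rewrite (comul_x3y nz2 iota2 zeta4 xyP actD coactD).
  rewrite expr2 hM !h'K (comul_yy nz2 iota2 zeta4 xyP actD coactD) /ysquare.
  rewrite -(comul_x3 nz2 iota2 zeta4 xyP actD coactD).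
  case: t; rewrite (linear_propZ lh) !(linear_propD lh) (linear_propN lh)
     !(linear_propZ lh) ?X2 ?X3 ?h'K h1 //.
have [f [[lf f1 fM] fx fy]] := presented_hom rel.
exists (h \o f); split=> /=.
- exact: linear_comp.
- by rewrite f1.
- by move=> a b; rewrite fM hM.
- by rewrite fx h'K.
- by rewrite fy h'K.
Qed.

Lemma exists_example : exists D : ydhopf G22 A, example_structure iota zeta x y t D.
Proof.
have [D [actD coactD]] := exists_action.
have [F [lF F1 FM Fx Fy]] := exists_comul actD coactD.
have [e [eh ex ey]] := presented_hom relations_counit.
have bB := glikes_basis nz2 iota2 zeta4 xyP.
(* The values are listed in the order of [glikes]: positions 0 to 3 are the omega_i, positions 4 to
   7 the eta_i. *)
pose vals : seq A := [:: omega1 A; omega2 iota zeta x; omega3 iota zeta x; omega4 x] ++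
  match t with
  | TypeI =>
    [:: 2^-1 *: (eta1 y + zeta^-1 *: eta2 x y + eta3 x y - zeta^-1 *: eta4 x y);
        2^-1 *: (zeta^-1 *: eta1 y + eta2 x y - zeta^-1 *: eta3 x y + eta4 x y);
        2^-1 *: (eta1 y - zeta^-1 *: eta2 x y + eta3 x y + zeta^-1 *: eta4 x y);
        2^-1 *: (- (zeta^-1 *: eta1 y) + eta2 x y + zeta^-1 *: eta3 x y + eta4 x y)]
  | TypeII =>
    [:: 2^-1 *: (zeta^-1 *: eta1 y + eta2 x y - zeta^-1 *: eta3 x y + eta4 x y);
        2^-1 *: (eta1 y + zeta^-1 *: eta2 x y + eta3 x y - zeta^-1 *: eta4 x y);
        2^-1 *: (- (zeta^-1 *: eta1 y) + eta2 x y + zeta^-1 *: eta3 x y + eta4 x y);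
        2^-1 *: (eta1 y - zeta^-1 *: eta2 x y + eta3 x y + zeta^-1 *: eta4 x y)]
  end.
have [|s [ls sE]] := @basis_linear_map _ _ _ _ vals bB.
  by rewrite /vals; case: t.
exists (YDHopf (ydh_str D) F e s); split=> //.
split=> //=.
  split; [exact: (sE 0) | exact: (sE 1) | exact: (sE 2) | exact: (sE 3)].
move: sE; rewrite /vals; case: t => sE;
  split; [exact: (sE 4) | exact: (sE 5) | exact: (sE 6) | exact: (sE 7) 
        | exact: (sE 4) | exact: (sE 5) | exact: (sE 6) | exact: (sE 7)].
Qed.

End ExampleExistence.

(** * Hopf algebra axioms and the core *)

Lemma basis_linear_ext (K : fieldType) (V W : vectType K) (bs : seq V) (f f' : V -> W) :
  basis_of fullv bs -> linear f -> linear f' -> (forall b, b \in bs -> f b = f' b) -> f =1 f'.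
Proof.
move=> bB lf lf' E v; rewrite (coord_basis (X := in_tuple bs) bB (memvf v)).
rewrite (linear_prop_sum lf) (linear_prop_sum lf'); apply: eq_bigr => i _.
by rewrite (linear_propZ lf) (linear_propZ lf') E ?mem_nth.
Qed.

Lemma mul_bilin (K : fieldType) (A : falgType K) : bilin (fun a b : A => a * b).
Proof.
split=> [a k b c | a k b c]; first by rewrite mulrDr scalerAr.
by rewrite mulrDl scalerAl.
Qed.

Lemma tens_vs_mem (K : fieldType) (V W : vectType K) (S : {vspace V}) (T : {vspace W}) v w :
  v \in S -> w \in T -> v \tens w \in tens_vs S T.
Proof.
move=> vS wT; rewrite (coord_vbasis vS) (coord_vbasis wT) tens_suml.
apply: rpred_sum => i _; rewrite tensZl tens_sumr; apply/rpredZ/rpred_sum => j _.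
by rewrite tensZr; apply/rpredZ/memv_span/allpairs_f; rewrite mem_nth ?size_tuple.
Qed.

(** The line through a group-like element is a subcoalgebra, and it is simple because it is
    one-dimensional; a basis of such elements makes A the sum of these lines. *)
Lemma cosemisimple_glikes (K : fieldType) (gT : finGroupType) (A : falgType K)
  (D : ydhopf gT A) (bs : seq A) : linear (comul D) -> basis_of fullv bs ->
  (forall b, b \in bs -> grouplike D b) -> cosemisimple D.
Proof.
move=> lD bB bG; exists [seq <[b]>%VS | b <- bs]; split=> [C /mapP[b bb ->] |]; last first.
  by rewrite big_map -span_def; apply: span_basis.
have b0 : b != 0 by apply: basis_not0 bB bb.
split=> [|a /vlineP[k ->] | C' C'b _].
- by rewrite -dimv_eq0 dim_vline b0.
- rewrite (linear_propZ lD) (bG b bb).1; apply: rpredZ.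
  by apply: tens_vs_mem; apply: memv_line.
have [->|C'0] := eqVneq C' 0%VS; [by left | right; apply/eqP].
by rewrite eqEdim C'b dim_vline b0 lt0n dimv_eq0.
Qed.

Lemma span_linear_ext (K : fieldType) (V W : vectType K) (bs : seq V) (f f' : V -> W) :
  linear f -> linear f' -> {in bs, f =1 f'} -> {in <<bs>>%VS, f =1 f'}.
Proof.
move=> lf lf' E v vS; rewrite (coord_span (X := in_tuple bs) vS).
rewrite (linear_prop_sum lf) (linear_prop_sum lf'); apply: eq_bigr => i _.
by rewrite (linear_propZ lf) (linear_propZ lf') E ?mem_nth.
Qed.

Lemma dual_functional (K : fieldType) (V : vectType K) (bs : seq V) b0 :
  basis_of fullv bs -> b0 \in bs ->
  exists F : V -> K^o, linear F /\ {in bs, forall b, F b = (b == b0)%:R}.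
Proof.
move=> bB b0b; have fB := basis_free bB; have uB := free_uniq fB.
have ib b : b \in bs -> (index b bs < size bs)%N by rewrite index_mem.
exists (coord (in_tuple bs) (Ordinal (ib _ b0b)) : V -> K^o); split=> [k u v|b bb].
  by rewrite linearP.
have /= := coord_free (X := in_tuple bs) (Ordinal (ib _ bb)) (Ordinal (ib _ b0b)) fB.
rewrite nth_index // => ->; congr ((nat_of_bool _)%:R); apply/eqP/eqP => [[E] | E].
  by rewrite -(nth_index 0 bb) E nth_index.
by apply/val_inj; rewrite /= E.
Qed.

Section TensorAlgebra.
Variables (K : fieldType) (A : falgType K).

Lemma tmul_tens (a b c d : A) : tmul (a \tens b) (c \tens d) = (a * c) \tens (b * d).
Proof.
move: a b c d; have bF (a b : A) : bilin (fun a' b' : A => (a * a') \tens (b * b')).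
  by split=> [u k v w | u k v w]; rewrite mulrDr -scalerAr !tensE.
move=> a b c d; rewrite /tmul tlift_tens ?tlift_tens //.
split=> u; apply: tlift_linear_param => v w k z z'; by rewrite mulrDl -scalerAl !tensE.
Qed.

Lemma tmul_bilin : bilin (@tmul K A).
Proof.
split=> [s | t]; last exact: tlift_linear.
apply: tlift_linear_param => a b; exact: tlift_linear.
Qed.

End TensorAlgebra.

Section ExampleHopf.
Variables (K : fieldType) (iota zeta : K) (t : alg_kind) (A : falgType K) (x y : A).
Hypotheses (nz2 : (2 : K) != 0) (iota2 : iota ^+ 2 = -1) (zeta4 : zeta ^+ 4 = 1).
Hypothesis xyP : presented t zeta x y.
Variable D : ydhopf G22 A.
Hypothesis exD : example_structure iota zeta x y t D.

Local Notation om := (om iota zeta x).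
Local Notation et := (et x y).
Local Notation a := (gact D).
Let xM := xM xyP.
Let actD : example_action x y D. Proof. by case: exD. Qed.
Let coactD : example_coaction zeta D. Proof. by case: exD. Qed.
Let DP := example_theta xyP actD coactD.
Let thP := theta_bicharacter nz2 zeta4.
Let comulL : linear (comul D). Proof. by case: exD => _ _ []. Qed.
Let counitL : linear (counit D). Proof. by case: exD => _ _ _ [[]]. Qed.
Let antipL : linear (antip D). Proof. by case: exD => _ _ _ _ []. Qed.
Let bB := glikes_basis nz2 iota2 zeta4 xyP.

Lemma mem_om g : om g \in glikes iota zeta x y.
Proof. by rewrite mem_cat map_f //; move: g; apply: G22_cases. Qed.

Lemma mem_et g : et g \in glikes iota zeta x y.
Proof. by rewrite mem_cat orbC map_f //; move: g; apply: G22_cases. Qed.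

Lemma glikesP (P : A -> Prop) : (forall g, P (om g)) -> (forall g, P (et g)) ->
  forall b, b \in glikes iota zeta x y -> P b.
Proof. by move=> Po Pe b; rewrite mem_cat => /orP[] /mapP[g _ ->]. Qed.

Lemma comul_om g : comul D (om g) = om g \tens om g.
Proof.
have [_ _ [_ c1 cM cx cy] _ _] := exD.
have cx2 : comul D (x ^+ 2) = x ^+ 2 \tens x ^+ 2.
  by rewrite expr2 cM cx (comul_x2 nz2 iota2 zeta4 xyP actD coactD).
have cx3 : comul D (x ^+ 3) =
    2^-1 *: (x ^+ 3 \tens x ^+ 3 + x ^+ 3 \tens x + x \tens x ^+ 3 - x \tens x).
  by rewrite {1}exprSr cM cx2 cx (comul_x3 nz2 iota2 zeta4 xyP actD coactD).
move: g; apply: G22_cases; rewrite /om /g22_case /= ?c1 ?cx2 //;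
  rewrite /omega2 /omega3 (linear_propD comulL) !(linear_propZ comulL) cx cx3 !tensE;
  by module K; coef_field.
Qed.

Lemma comul_et g : comul D (et g) = et g \tens et g.
Proof.
have [_ _ [_ c1 cM cx cy] _ _] := exD.
have cx2 : comul D (x ^+ 2) = x ^+ 2 \tens x ^+ 2 by exact: (comul_om g4).
have cx3 : comul D (x ^+ 3) = bmul D (comul D (x ^+ 2)) (comul D x).
  by rewrite {1}exprSr cM.
move: g; apply: G22_cases.
- exact: cy.
- rewrite /et /g22_case /= {1}/eta2 cM cy cx3 cx2 cx.
  rewrite (comul_x3 nz2 iota2 zeta4 xyP actD coactD).
  by rewrite (comul_x3y nz2 iota2 zeta4 xyP actD coactD).
- by rewrite /et /g22_case /= {1}/eta3 cM cy cx2 (comul_x2y nz2 iota2 zeta4 xyP actD coactD).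
- by rewrite /et /g22_case /= {1}/eta4 cM cy cx (comul_xy nz2 iota2 zeta4 xyP actD coactD).
Qed.

Lemma counit_om g : counit D (om g) = 1.
Proof.
have [_ _ _ [eH ex ey] _] := exD.
move: g; apply: G22_cases; rewrite /om /g22_case /= ?(alg_hom1 eH) //.
- rewrite /omega2 (linear_propD counitL) !(linear_propZ counitL) ?(alg_homX _ _ eH) ex expr1n.
  by rewrite /GRing.scale /=; coef_field.
- rewrite /omega3 (linear_propD counitL) !(linear_propZ counitL) ?(alg_homX _ _ eH) ex expr1n.
  by rewrite /GRing.scale /=; coef_field.
- by rewrite /omega4 (alg_homX _ _ eH) ex expr1n.
Qed.

Lemma counit_et g : counit D (et g) = 1.
Proof.
have [_ _ _ [eH ex ey] _] := exD.
by move: g; apply: G22_cases; rewrite /et /g22_case /= /eta1 /eta2 /eta3 /eta4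
  ?(alg_homM eH) ?(alg_homX _ _ eH) ?ex ?ey ?expr1n ?mulr1.
Qed.

Lemma glikes_grouplike b : b \in glikes iota zeta x y -> grouplike D b.
Proof.
move: b; apply: glikesP => g; split; rewrite ?comul_om ?comul_et ?counit_om ?counit_et //.
Qed.

Lemma antip_om g : antip D (om g) = om g.
Proof. by case: exD => _ _ _ _ [_ [? ? ? ?] _]; move: g; apply: G22_cases. Qed.

Lemma zetaV : zeta^-1 = zeta ^+ 3.
Proof.
have z0 : zeta != 0.
  by apply: contraTneq isT => z0; move: zeta4; rewrite z0 expr0n => /eqP; rewrite eq_sym oner_eq0.
by apply: (mulfI z0); rewrite mulfV // -exprS.
Qed.

(** The four prescribed values of S form a single orbit under G. This gives equivariance of S and
    reduces the antipode axiom to the element y. *)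
Lemma antip_et g : antip D (et g) = a g (antip D y).
Proof.
have E h : a g (et h) = et (g * h)%g by apply: (act_et xyP actD).
have lA := act_lin actD g.
case: exD => _ _ _ _ [_ _]; rewrite zetaV.
rewrite -[eta1 y]/(et g1) -[eta2 x y]/(et g2) -[eta3 x y]/(et g3) -[eta4 x y]/(et g4).
move=> S; change (antip D (et g) = a g (antip D (et g1))).
have lN := linear_propN lA; have lD := linear_propD lA; have lZ := linear_propZ lA.
move: E S; move: g lA lN lD lZ; apply: G22_cases => lA lN lD lZ E; case: t => -[S1 S2 S3 S4];
  rewrite ?S1 ?S2 ?S3 ?S4 lZ !(lD, lN, lZ) !E !G22_mulE; module K; coef_field.
Qed.

(** The prescribed value factors as S(y) = c y, where c is a polynomial in x inverse to y^2 and
    commuting with y; hence S(y) = y^-1. *)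
Lemma antip_y : antip D y * y = 1 /\ y * antip D y = 1.
Proof.
case: exD => _ _ _ _ [_ _]; rewrite zetaV => S.
have uE := relyy xyP.
suff E : exists2 c : A, antip D y = c * y & c * (y * y) = 1 /\ y * c * y = c * (y * y).
  by case: E => c -> [E1 E2]; rewrite -!mulrA E1 mulrA E2.
exists (match t with
 | TypeI => 2^-1 *: (1 + zeta ^+ 3 *: x ^+ 3 + x ^+ 2 - zeta ^+ 3 *: x)
 | TypeII => 2^-1 *: (zeta ^+ 3 *: 1 + x ^+ 3 - zeta ^+ 3 *: x ^+ 2 + x)
 end).
  move: S; case: t => -[-> _ _ _]; rewrite /eta1 /eta2 /eta3 /eta4;
  by rewrite -scalerAl !(mulrDl, mulNr) -!scalerAl mul1r.
split.
  rewrite uE; case: t; rewrite -!scalerAl -!scalerAr ?(mulrDl, mulrDr, mulNr, mulrN);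
    rewrite -?scalerAl -?scalerAr ?(mulrDl, mulrDr, mulNr, mulrN) -?scalerAl -?scalerAr ?xM;
    rewrite ?mul1r ?mulr1; module K; coef_field.
rewrite mulrA; congr (_ * y).
have := (yx1 xyP, yx2 xyP, yx3 xyP); case: t => E;
  rewrite -scalerAr -scalerAl !(mulrDr, mulrDl, mulrN, mulNr) -!scalerAr -!scalerAl !E mulr1 mul1r;
  module K; coef_field.
Qed.

Lemma example_is_ydhopf : is_ydhopf D.
Proof.
have [_ _ [_ c1 cM cx cy] [eH ex ey] _] := exD.
have DP2 := theta_module_tens thP DP DP.
have aL g := act_lin actD g; have aM g := alg_homM (act_hom actD g).
have a1 g := alg_hom1 (act_hom actD g).
have bext := basis_linear_ext bB.
have tB : bilin (fun b c : A => antip D b * c).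
  split=> [b k c c' | c k b b']; first by rewrite mulrDr scalerAr.
  by rewrite antipL mulrDl scalerAl.
have tB' : bilin (fun b c : A => b * antip D c).
  split=> [b k c c' | c k b b']; last by rewrite mulrDl scalerAl.
  by rewrite antipL mulrDr scalerAr.
have gg (g : G22) : (g * g = 1)%g by move: g; apply: G22_cases; rewrite G22_mulE.
split.
- exact: theta_module_yd DP.
- apply: (theta_module_mor DP2 DP); first exact: tlift_linear.
  move=> g v; rewrite (yd_tens_gact DP DP); move: v; apply: tens_ext => [||b c].
  + exact: linear_comp (tlift_linear _) (tmap_linear _ _).
  + exact: linear_comp (aL g) (tlift_linear _).
  + by rewrite tmap_tens // !tlift_tens ?aM //; apply: mul_bilin.
- apply: (theta_module_mor (theta_module_triv thP) DP) => [k u v | g v].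
    by rewrite scalerDl scalerA.
  rewrite (linear_propZ (aL g)) a1 /gact /= KGcounit_gelt scale1r //.
- apply: (theta_module_mor DP DP2) => // g v; rewrite (yd_tens_gact DP DP); move: v.
  apply: bext; [exact: linear_comp comulL (aL g)|exact: linear_comp (tmap_linear _ _) comulL|].
  apply: glikesP => h.
    by rewrite (act_om iota xyP actD) !comul_om tmap_tens // (act_om iota xyP actD).
  by rewrite (act_et xyP actD) !comul_et tmap_tens // (act_et xyP actD).
- apply: (theta_module_mor DP (theta_module_triv thP)) => // g v.
  rewrite {2}/gact /= KGcounit_gelt scale1r; move: v.
  apply: bext; [exact: linear_comp counitL (aL g)|exact: counitL|].
  by apply: glikesP => h; rewrite ?(act_et xyP actD) ?(act_om iota xyP actD) ?counit_om ?counit_et.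
- apply: (theta_module_mor DP DP) => // g v; move: v.
  apply: bext; [exact: linear_comp antipL (aL g)|exact: linear_comp (aL g) antipL|].
  apply: glikesP => h; first by rewrite antip_om !(act_om iota xyP actD) antip_om.
  by rewrite (act_et xyP actD) !antip_et (act_mul xyP actD).
- apply: bext => [||b bb].
  + exact: linear_comp (@tassoc_linear _ _ _ _) (linear_comp (tmap_linear _ _) comulL).
  + exact: linear_comp (tmap_linear _ _) comulL.
  + have [E _] := glikes_grouplike bb.
    by rewrite E !tmap_tens // E tassoc_tens.
- apply: bext => [||b bb] //; first exact: linear_comp (tlift_linear _) comulL.
  have [E e1] := glikes_grouplike bb.
  rewrite E tlift_tens ?e1 ?scale1r //; split=> [c k u v | c k u v].
    by rewrite scalerDr !scalerA mulrC.
  by rewrite counitL scalerDl scalerA.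
- apply: bext => [||b bb] //; first exact: linear_comp (tlift_linear _) comulL.
  have [E e1] := glikes_grouplike bb.
  rewrite E tlift_tens ?e1 ?scale1r //; split=> [c k u v | c k u v].
    by rewrite counitL scalerDl scalerA.
  by rewrite scalerDr !scalerA mulrC.
- exact: c1.
- exact: cM.
- exact: alg_hom1 eH.
- exact: alg_homM eH.
- have lE : linear (fun v => (counit D v : K)%:A : A).
    by move=> k u v; rewrite counitL scalerDl scalerA.
  apply: bext => //; first exact: linear_comp (tlift_linear _) comulL.
  apply: glikesP => g.
    by rewrite comul_om counit_om tlift_tens // antip_om (omM nz2 iota2 zeta4 xyP) gg scale1r.
  rewrite comul_et counit_et tlift_tens // antip_et scale1r.
  (* S(g.y)(g.y) = g.(S(y) y) = g.1 = 1, since g acts by an algebra homomorphism. *)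
  by rewrite -{2}(mulg1 g) -(act_et xyP actD) -aM (proj1 antip_y) a1.
- have lE : linear (fun v => (counit D v : K)%:A : A).
    by move=> k u v; rewrite counitL scalerDl scalerA.
  apply: bext => //; first exact: linear_comp (tlift_linear _) comulL.
  apply: glikesP => g.
    by rewrite comul_om counit_om tlift_tens // antip_om (omM nz2 iota2 zeta4 xyP) gg scale1r.
  rewrite comul_et counit_et tlift_tens // antip_et scale1r.
  by rewrite -{1}(mulg1 g) -(act_et xyP actD) -aM (proj2 antip_y) a1.
Qed.

Lemma example_cocommutative : cocommutative D.
Proof.
apply: (basis_linear_ext bB); [exact: linear_comp (tlift_linear _) comulL | exact: comulL |].
by move=> b /glikes_grouplike[-> _]; rewrite tswap_tens.
Qed.

Lemma example_cosemisimple : cosemisimple D.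
Proof. exact: cosemisimple_glikes comulL bB glikes_grouplike. Qed.

(** * Commutativity, nontriviality and the core of y *)

Local Notation C := (core_span iota zeta x).
Let omM := omM nz2 iota2 zeta4 xyP.
Let uniq_glikes : uniq (glikes iota zeta x y) := free_uniq (basis_free bB).

Lemma om_et_eq : [/\ injective om, injective et & forall g h, om g != et h].
Proof.
have all4 (g : G22) : g \in [:: g1; g2; g3; g4] by move: g; apply: G22_cases.
have inj (f : G22 -> A) : uniq [seq f g | g <- [:: g1; g2; g3; g4]] -> injective f.
  set s := [:: g1; _; _; _] => uf g h E.
  have sP g' : (index g' s < size s)%N by rewrite index_mem all4.
  have := nth_uniq (f g1) (s := map f s) (i := index g s) (j := index h s).
  rewrite size_map => /(_ (sP g) (sP h) uf).
  rewrite !(nth_map g1) // !nth_index ?all4 // E eqxx => /esym/eqP.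
  exact: (index_inj g1 (all4 g) (all4 h)).
move: uniq_glikes; rewrite cat_uniq => /and3P[u1 u2 u3]; split; try exact: inj.
move=> g h; apply: contraNneq u2 => E; apply/hasP; exists (et h); first exact: map_f.
by rewrite -E map_f.
Qed.

Lemma om_inj : injective om. Proof. by case: om_et_eq. Qed.
Lemma et_inj : injective et. Proof. by case: om_et_eq. Qed.

(** Used in two rounds: with c a generator it makes x and y central, and then it applies to an
    arbitrary c. *)
Lemma comm_generators (c b : A) : c * x = x * c -> c * y = y * c -> c * b = b * c.
Proof.
move=> cx cy; have [_ /(_ b)[p [q ->]]] := presented_span xyP.
have cX n : GRing.comm c (x ^+ n) by apply: commrX.
have cS (r : 'I_4 -> K) : GRing.comm c (\sum_i r i *: x ^+ i).
  apply: commr_sum => i _; rewrite /GRing.comm -scalerAl -scalerAr.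
  by rewrite cX.
by apply: commrD; [exact: cS | apply: commrM; [exact: cS|]].
Qed.

Lemma example_commutative : t = TypeI -> forall b c : A, b * c = c * b.
Proof.
move=> tI; have yx := yx1 xyP; rewrite tI in yx.
have xC b : x * b = b * x by apply: comm_generators.
have yC b : y * b = b * y by apply: comm_generators.
by move=> b c; apply: comm_generators.
Qed.

(** Since y x = x^3 y, commutativity would identify eta_4 = x y with eta_2 = x^3 y. *)
Lemma example_noncommutative : t = TypeII -> ~ forall b c : A, b * c = c * b.
Proof.
move=> tII mC; have := yx1 xyP; rewrite tII mC => E.
by have /et_inj := (E : et g4 = et g2).
Qed.

(** In the braiding of y (x) omega_2, the coefficient of omega_3 (x) eta_1 comes from g in {g_2,
    g_4} and g' = g_1, and equals (1 + 1)/4 = 1/2; the flip has coefficient 0 there. The functionals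
    [F] and [G] extract this coefficient. *)
Lemma example_nontrivial : ~ trivial_on D {:A}.
Proof.
move=> /(_ y (om g2) (memvf _) (memvf _)); rewrite (yd_braid_tens _ _ DP DP).
rewrite /rsum cardG22 !sumG22 !thetaE !(act_om iota xyP actD) !(act_y xyP actD) /= => E.
have [F [lF FE]] := dual_functional bB (mem_om g3).
have F2 : F (om g2) = 0 by rewrite FE ?mem_om // (inj_eq om_inj).
have F3 : F (om g3) = 1 by rewrite FE ?mem_om // eqxx.
have bFl : bilin (fun v w : A => (F v : K) *: w).
  split=> [v k w w' | w k v v']; first by rewrite scalerDr !scalerA mulrC.
  by rewrite lF scalerDl scalerA.
have [T [lT TE]] : exists T : A \ox A -> A,
    linear T /\ forall v w, T (v \tens w) = (F v : K) *: w.
  exists (tlift (fun v w : A => (F v : K) *: w)).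
  by split=> [|v w]; [exact: tlift_linear | rewrite tlift_tens].
have := congr1 T E.
rewrite !(linear_propZ lT) !(linear_propD lT) !(linear_propZ lT) !TE.
rewrite [g22_case _ _ _ _ g2]/= F2 F3 !scale0r.
have [G [lG GE]] := dual_functional bB (mem_et g1).
move=> /(congr1 G).
have GE1 : G (et g1) = 1 by rewrite GE ?mem_et // eqxx.
have GE2 : G (et g2) = 0 by rewrite GE ?mem_et // (inj_eq et_inj).
have GE3 : G (et g3) = 0 by rewrite GE ?mem_et // (inj_eq et_inj).
have GE4 : G (et g4) = 0 by rewrite GE ?mem_et // (inj_eq et_inj).
rewrite !(linear_propZ lG, linear_propD lG, linear_prop0 lG) GE1 GE2 GE3 GE4.
rewrite /GRing.scale /= => /eqP; apply/negP.
rewrite (_ : 4^-1 * _ = 2^-1); first by rewrite invr_eq0.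
by coef_field.
Qed.

Lemma core_spanE : C = <<[seq om g | g <- [:: g1; g2; g3; g4]]>>%VS.
Proof. by []. Qed.

Lemma dim_core : \dim C = 4%N.
Proof.
rewrite core_spanE; apply/eqP; apply: (catl_free (Y := [seq et g | g <- [:: g1; g2; g3; g4]])).
exact: basis_free bB.
Qed.

Definition core_iso (h : groupAlg K G22) : A := \sum_g (h g : K) *: om g.

Lemma core_iso_linear : linear core_iso.
Proof. exact: (@linear_coefs K G22). Qed.

Lemma core_iso_gelt (g : G22) : core_iso (gelt K g) = om g.
Proof. exact: (@sum_gelt K G22). Qed.

Lemma core_om g : om g \in C.
Proof. by rewrite core_spanE; apply/memv_span/map_f; move: g; apply: G22_cases. Qed.

Lemma mem_core b : b \in C <-> exists h, core_iso h = b.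
Proof.
split=> [bC | [h <-]]; last by apply: rpred_sum => g _; apply/rpredZ/core_om.
have := bC; rewrite core_spanE => /(coord_span (X := in_tuple _)) ->.
set X := in_tuple _.
exists (\sum_i coord X i b *: gelt K (nth g1 [:: g1; g2; g3; g4] i)).
rewrite (linear_prop_sum core_iso_linear); apply: eq_bigr => i _.
rewrite (linear_propZ core_iso_linear) core_iso_gelt; congr (_ *: _).
by rewrite (nth_map g1) // -(size_map om) ltn_ord.
Qed.

Lemma core_iso_inj : injective core_iso.
Proof.
move=> h k E; apply/ffunP => g.
have [F [lF FE]] := dual_functional bB (mem_om g).
suff FV u : F (core_iso u) = u g by rewrite -!FV E.
rewrite (linear_prop_sum lF) (bigD1 g) //= big1 => [|g' g'g].
  by rewrite (linear_propZ lF) FE ?mem_om // eqxx addr0 [LHS]mulr1.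
by rewrite (linear_propZ lF) FE ?mem_om // (inj_eq om_inj) (negPf g'g) [LHS]mulr0.
Qed.

Lemma core_isoM h k : core_iso (h * k) = core_iso h * core_iso k.
Proof.
have lI := core_iso_linear.
move: h; apply: groupAlg_ext => [u v w|u v w|g].
- by rewrite mulrDl -scalerAl lI.
- by rewrite lI mulrDl scalerAl.
move: k; apply: groupAlg_ext => [u v w|u v w|h].
- by rewrite mulrDr -scalerAr lI.
- by rewrite lI mulrDr scalerAr.
by rewrite -geltM !core_iso_gelt omM.
Qed.

Lemma core_iso_comul h : comul D (core_iso h) = tmap core_iso core_iso (KGcomul h).
Proof.
have lI := core_iso_linear.
move: h; apply: groupAlg_ext => [||g].
- exact: linear_comp comulL lI.
- exact: linear_comp (tmap_linear _ _) (@KGcomul_linear _ _).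
rewrite KGcomul_gelt tmap_tens // !core_iso_gelt.
exact: comul_om.
Qed.

Lemma core_iso_counit h : counit D (core_iso h) = KGcounit h.
Proof.
have lI := core_iso_linear.
move: h; apply: groupAlg_ext => [||g].
- exact: linear_comp counitL lI.
- exact: KGcounit_linear.
by rewrite KGcounit_gelt core_iso_gelt counit_om.
Qed.

Lemma core_iso_antip h : antip D (core_iso h) = core_iso (KGantip h).
Proof.
have lI := core_iso_linear.
move: h; apply: groupAlg_ext => [||g].
- exact: linear_comp antipL lI.
- exact: linear_comp lI (@KGantip_linear _ _).
rewrite KGantip_gelt !core_iso_gelt antip_om.
by move: g; apply: G22_cases.
Qed.

Lemma core_iso_onto : hopf_iso_onto D C core_iso.
Proof.
split.
- exact: core_iso_linear.
- exact: core_iso_inj.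
- exact: mem_core.
- exact: (core_iso_gelt g1).
- exact: core_isoM.
- exact: core_iso_comul.
- exact: core_iso_counit.
- exact: core_iso_antip.
Qed.

Lemma core_elt_core c : c \in C -> core_elt D c.
Proof.
have lA g := act_lin actD g.
case/mem_core=> h <-; split; move: h; apply: groupAlg_ext => [||g];
  rewrite ?core_iso_gelt ?(act_om iota xyP actD) //;
  exact: core_iso_linear || exact: linear_comp (lA _) core_iso_linear.
Qed.

(** The cancellation of [bmul_core] again: between two elements fixed by g_3, contraction with R is
    the identity. *)
Lemma core_trivial : trivial_on D C.
Proof.
move=> b c /core_elt_core[b3 b4] /core_elt_core[c3 c4].
rewrite (yd_braid_tens _ _ DP DP) /rsum cardG22 !sumG22 !thetaE.
rewrite !b3 !b4 !c3 !c4 -![a g1 _]/(a 1%g _) !(act1g actD).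
by module K; coef_field.
Qed.

Lemma core_ordinary : ordinary_hopf_on D C.
Proof.
have [_ _ _ _ _ _ Hass Hl Hr c1 cM e1 eM Sl Sr] := example_is_ydhopf.
split => //.
- exact: (core_om g1).
- move=> b c /mem_core[h <-] /mem_core[k <-]; apply/mem_core; exists (h * k).
  exact: core_isoM.
- move=> b /mem_core[h <-]; rewrite (linear_prop_sum comulL); apply: rpred_sum => g _.
  rewrite (linear_propZ comulL) comul_om; apply: rpredZ.
  by apply: tens_vs_mem; apply: core_om.
- move=> b /mem_core[h <-]; apply/mem_core; exists (KGantip h).
  by rewrite core_iso_antip.
(* Delta is multiplicative for the braided product; on the core this agrees with the ordinary
   product of the tensor square by [bmul_core]. *)
move=> b c bC cC; rewrite cM; case/mem_core: bC => h <-; case/mem_core: cC => k <-.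
have [bl br] := bmul_bilin D; have [tl tr] := tmul_bilin A.
move: h; apply: groupAlg_ext => [u v w|u v w|g].
- by rewrite core_iso_linear comulL br.
- by rewrite core_iso_linear comulL tr.
move: k; apply: groupAlg_ext => [u v w|u v w|h].
- by rewrite core_iso_linear comulL bl.
- by rewrite core_iso_linear comulL tl.
rewrite !core_iso_gelt !comul_om tmul_tens.
rewrite (bmul_core nz2 iota2 zeta4 xyP actD coactD) //;
  by apply/core_elt_core/core_om.
Qed.

Lemma act_om2 : ydact D (gelt K g2) (om g2) = om g3.
Proof. exact: (act_om iota xyP actD). Qed.

Lemma om3_neq_om2 : om g3 <> om g2.
Proof. by move/om_inj. Qed.

Lemma core_not_completely_trivial : ~ completely_trivial_on D C.
Proof.
case=> /(_ (gelt K g2) (om g2) (core_om g2)) + _.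
by rewrite act_om2 KGcounit_gelt scale1r => /om3_neq_om2.
Qed.

Lemma coact_om2 : ydcoact D (om g2) =
  (2^-1 *: (gelt K g1 + gelt K g3)) \tens om g2 + (2^-1 *: (gelt K g1 - gelt K g3)) \tens om g3.
Proof.
rewrite (tm_coact DP) /rsum cardG22 !sumG22 !thetaE !(act_om iota xyP actD) /= !tensE.
by module K; coef_field.
Qed.

Lemma coact_om3 : ydcoact D (om g3) =
  (2^-1 *: (gelt K g1 - gelt K g3)) \tens om g2 + (2^-1 *: (gelt K g1 + gelt K g3)) \tens om g3.
Proof.
rewrite (tm_coact DP) /rsum cardG22 !sumG22 !thetaE !(act_om iota xyP actD) /= !tensE.
by module K; coef_field.
Qed.

Lemma Tgrp_y : Tgrp D y = [set 1%g].
Proof.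
apply/setP=> g; rewrite !inE -[ydact _ _ y]/(a g y) (act_y xyP actD).
exact: (inj_eq et_inj g g1).
Qed.

(** Comparing the coefficients of each eta_h shows that the transform of chi with respect to theta
    is concentrated at h = g_1; inverting the transform makes chi trivial. *)
Lemma Qgrp_y chi : in_Qgrp D y chi <-> chi =1 (fun=> 1).
Proof.
have E : tlift (fun (h : groupAlg K G22) (v : A) => char_ext chi h *: v) (ydcoact D y) =
    rsum (theta zeta) (fun g g' => chi g *: et g').
  rewrite (tm_coact DP) (linear_rsum _ _ (tlift_linear _)); apply: eq_rsum => g g'.
  have ceL : linear (char_ext chi : groupAlg K G22 -> K^o).
    exact: (linear_coefs (chi : G22 -> K^o)).
  have ceE h : char_ext chi (gelt K h) = chi h by apply: (sum_gelt (V := K^o)).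
  rewrite tlift_tens ?ceE ?(act_y xyP actD) //; split=> [h u v w | v u h k].
    by rewrite scalerDr !scalerA mulrC.
  by rewrite [char_ext _ _]ceL scalerDl scalerA.
split=> [[[chi1 _]] | chi1]; last first.
  split; first by split=> [|g h]; rewrite !chi1 ?mulr1.
  rewrite E (@eq_rsum _ _ _ _ _ (fun _ g' => et g')) => [|g g'].
    by rewrite (rsum_right thP).
  by rewrite chi1 scale1r.
rewrite E => yE.
have EQ h : 4^-1 * \sum_g theta zeta g h * chi g = (g1 == h)%:R.
  have [F [lF FE]] := dual_functional bB (mem_et h).
  have F1 g : F (et g) = (g == h)%:R by rewrite FE ?mem_et // (inj_eq et_inj).
  have := congr1 F yE; rewrite (linear_rsum _ _ lF) -[y]/(et g1) F1 => <-.
  rewrite /rsum cardG22; congr (_ * _); apply: eq_bigr => g _.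
  rewrite (bigD1 h) //= (linear_propZ lF) F1 eqxx big1 => [|h' h'h].
    by rewrite addr0 /GRing.scale /= mulr1.
  by rewrite (linear_propZ lF) F1 (negPf h'h) /GRing.scale /= !mulr0.
have eq4 h : \sum_g theta zeta g h * chi g = 4 * (g1 == h)%:R.
  by rewrite -EQ mulrA mulfV ?mul1r // nz4.
have := (eq4 g1, eq4 g2, eq4 g3, eq4 g4); rewrite !sumG22 !thetaE !mulr1 !mulr0 !mul1r chi1.
case=> [[[E1 E2] E3] E4].
have four_inj (u : K) : 4 * u = 4 -> u = 1.
  by move=> E5; apply: (mulfI (nz4 nz2)); rewrite E5 mulr1.
apply: G22_cases; apply: four_inj.
- by rewrite chi1 mulr1.
(* Inverse Fourier transform: 4 chi(g) is the sum over h of theta(g,h)^-1 times the equation for h,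
   where zeta^2 is its own inverse. Only the equation for g_1 has a nonzero right-hand side, namely
   4. *)
- have -> : 4 * chi g2 = (1 + chi g2 + chi g3 + chi g4)
      - (1 + -1 * chi g2 + chi g3 + -1 * chi g4) + zeta ^+ 2 *
      ((1 + zeta ^+ 2 * chi g2 + -1 * chi g3 + - zeta ^+ 2 * chi g4) -
       (1 + - zeta ^+ 2 * chi g2 + -1 * chi g3 + zeta ^+ 2 * chi g4)) by ring: zeta4.
  by rewrite E1 E2 E3 E4; ring.
- have -> : 4 * chi g3 = (1 + chi g2 + chi g3 + chi g4)
      + (1 + -1 * chi g2 + chi g3 + -1 * chi g4) -
      ((1 + zeta ^+ 2 * chi g2 + -1 * chi g3 + - zeta ^+ 2 * chi g4) +
       (1 + - zeta ^+ 2 * chi g2 + -1 * chi g3 + zeta ^+ 2 * chi g4)) by ring.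
  by rewrite E1 E2 E3 E4; ring.
- have -> : 4 * chi g4 = (1 + chi g2 + chi g3 + chi g4)
      - (1 + -1 * chi g2 + chi g3 + -1 * chi g4) - zeta ^+ 2 *
      ((1 + zeta ^+ 2 * chi g2 + -1 * chi g3 + - zeta ^+ 2 * chi g4) -
       (1 + - zeta ^+ 2 * chi g2 + -1 * chi g3 + zeta ^+ 2 * chi g4)) by ring: zeta4.
  by rewrite E1 E2 E3 E4; ring.
Qed.

Lemma om_neq_et g h : om g != et h. Proof. by case: om_et_eq. Qed.

Let zeta0 : zeta != 0.
Proof.
by apply: contraTneq isT => z0; move: zeta4; rewrite z0 expr0n => /eqP; rewrite eq_sym oner_eq0.
Qed.

Let iota0 : iota != 0.
Proof.
by apply: contraTneq isT => i0; move: iota2; rewrite i0 expr0n => /eqP;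
  rewrite eq_sym oppr_eq0 oner_eq0.
Qed.

Definition full_support (F : G22 -> A) (c : A) : Prop :=
  exists m : G22 -> K, (forall h, m h != 0) /\ c = \sum_h m h *: F h.

Lemma full_support_antip : full_support et (antip D y).
Proof.
case: exD => _ _ _ _ [_ _]; rewrite -[eta1 y]/(et g1) -[eta2 x y]/(et g2)
  -[eta3 x y]/(et g3) -[eta4 x y]/(et g4) => S.
exists (match t with
  | TypeI => g22_case 2^-1 (2^-1 * zeta^-1) 2^-1 (- (2^-1 * zeta^-1))
  | TypeII => g22_case (2^-1 * zeta^-1) 2^-1 (- (2^-1 * zeta^-1)) 2^-1
  end); split.
  by case: t; apply: G22_cases; rewrite /g22_case /= ?oppr_eq0 ?mulf_neq0 ?invr_eq0.
rewrite sumG22; move: S; case: t => -[S1 _ _ _]; rewrite [LHS]S1 /g22_case /=;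
  module K; (field: zeta4); rewrite ?zeta0 ?nz2 //.
Qed.

(** The coefficients come from x + x^3 = omega_2 + omega_3 and x - x^3 = iota zeta^2 (omega_3 -
    omega_2). *)
Lemma full_support_sgn s : s ^+ 2 = 1 ->
  full_support om (2^-1 *: (1 + (s * zeta) *: x + x ^+ 2 - (s * zeta) *: x ^+ 3)) /\
  full_support om (2^-1 *: ((s * zeta) *: 1 + x - (s * zeta) *: x ^+ 2 + x ^+ 3)).
Proof.
move=> s2; have s0 : s != 0.
  by apply: contraTneq isT => s0; move: s2; rewrite s0 expr0n => /eqP; rewrite eq_sym oner_eq0.
split.
  exists (g22_case 2^-1 (- (s * 2^-1 * iota * zeta ^+ 3)) (s * 2^-1 * iota * zeta ^+ 3) 2^-1).
  split; last first.
    rewrite sumG22 /g22_case /= {1}(x3_om x nz2 iota2 zeta4) {1}(x_om x nz2 iota2 zeta4).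
    rewrite (_ : om g1 = 1) // (_ : om g4 = x ^+ 2) //; module K; coef_field.
  by apply: G22_cases; rewrite /g22_case /= ?oppr_eq0 ?mulf_neq0 ?invr_eq0 ?expf_neq0.
exists (g22_case (s * 2^-1 * zeta) 2^-1 2^-1 (- (s * 2^-1 * zeta))).
split; last first.
  rewrite sumG22 /g22_case /= {1}(x3_om x nz2 iota2 zeta4) {1}(x_om x nz2 iota2 zeta4).
  rewrite (_ : om g1 = 1) // (_ : om g4 = x ^+ 2) //; module K; coef_field.
by apply: G22_cases; rewrite /g22_case /= ?oppr_eq0 ?mulf_neq0 ?invr_eq0 ?expf_neq0.
Qed.

(** Each y eta_g is a power of x times y^2. Multiplication by x shifts the coefficients (1, zeta, 1,
    -zeta) of 1, x, x^2, x^3 cyclically, so for both types only the four elements of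
    [full_support_sgn] with s = 1 and s = -1 occur. *)
Lemma full_support_yet g : full_support om (y * et g).
Proof.
have [P1 P2] : full_support om (2^-1 *: (1 + (1 * zeta) *: x + x ^+ 2 - (1 * zeta) *: x ^+ 3)) /\
  full_support om (2^-1 *: ((1 * zeta) *: 1 + x - (1 * zeta) *: x ^+ 2 + x ^+ 3)).
  by apply: full_support_sgn; rewrite expr1n.
have [N1 N2] : full_support om (2^-1 *: (1 + (-1 * zeta) *: x + x ^+ 2 - (-1 * zeta) *: x ^+ 3)) /\
  full_support om (2^-1 *: ((-1 * zeta) *: 1 + x - (-1 * zeta) *: x ^+ 2 + x ^+ 3)).
  by apply: full_support_sgn; rewrite expr2 mulrNN mulr1.
have [uE E1 E2 E3] := And4 (relyy xyP) (yx1 xyP) (yx2 xyP) (yx3 xyP).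
have yE : [/\ y * et g1 = y * y, y * et g2 = y * x ^+ 3 * y, y * et g3 = y * x ^+ 2 * y
  & y * et g4 = y * x * y] by split; rewrite ?mulrA.
case: yE => y1 y2 y3 y4.
have fsE c c' : c' = c -> full_support om c -> full_support om c' by move=> ->.
move: g; apply: G22_cases; rewrite ?y1 ?y2 ?y3 ?y4 ?E1 ?E2 ?E3 -?(mulrA _ y y) uE;
  case: t; rewrite ?mul1r -?scalerAr ?(mulrDr, mulrN) -?scalerAr ?xM ?mulr1;
  solve [ by apply: (fsE _ _ _ P1); module K; coef_field
        | by apply: (fsE _ _ _ P2); module K; coef_field
        | by apply: (fsE _ _ _ N1); module K; coef_field
        | by apply: (fsE _ _ _ N2); module K; coef_field ].
Qed.

(** [appears_in] allows any basis [X] of group-like elements, but by [grouplike_in_basis] such a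
    basis contains all eta_h, so coordinates can be compared. *)
Lemma appears_in_antip eta' : appears_in D eta' (antip D y) -> exists g, eta' = et g.
Proof.
case=> n [X [i [XB XG Xi ci]]].
have inX b : grouplike D b -> b \in X by apply: grouplike_in_basis.
have [m [_ SE]] := full_support_antip.
have gl b := @glikes_grouplike b.
have : eta' \in glikes iota zeta x y.
  apply: (grouplike_in_basis comulL counitL (X := in_tuple (glikes iota zeta x y))) => //.
  by rewrite -Xi; apply/XG/mem_tnth.
rewrite mem_cat => /orP[] /mapP[g _ E]; last by exists g.
(* If eta' were some omega_g, it would differ from every eta_h; as S(y) is a combination of the
   eta_h, its coordinate at eta' would be 0. *)
case/eqP: ci; rewrite SE linear_sum big1 // => h _; rewrite linearZ_LR /=.
have /tnthP[j Ej] := inX _ (gl _ (mem_et h)).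
rewrite Ej (tnth_nth 0) (coord_free _ _ (basis_free XB)).
case: eqP => [ji|_]; last by rewrite [LHS]mulr0.
by have := om_neq_et g h; rewrite -E -Xi Ej ji eqxx.
Qed.

Lemma appears_in_exists : exists eta', appears_in D eta' (antip D y).
Proof.
have [m [m0 SE]] := full_support_antip.
have fB := basis_free bB.
exists (et g1), (size (glikes iota zeta x y)), (in_tuple (glikes iota zeta x y)).
(* Position 4 of [glikes] is eta_1, the first entry after the four omega_i. *)
have lt4 : (4 < size (glikes iota zeta x y))%N by [].
exists (Ordinal lt4); split=> //.
- by move=> b; apply: glikes_grouplike.
have lt i : (i < 4)%N -> (4 + i < size (glikes iota zeta x y))%N.
  by case: i => [|[|[|[|]]]].
rewrite SE linear_sum sumG22 /= !linearZ_LR /=.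
have cE i (Hi : (i < 4)%N) : coord (in_tuple (glikes iota zeta x y)) (Ordinal lt4)
    (et (nth g1 [:: g1; g2; g3; g4] i)) = (i == 0%N)%:R.
  have := coord_free (X := in_tuple (glikes iota zeta x y)) (Ordinal (lt i Hi)) (Ordinal lt4) fB.
  by case: i Hi => [|[|[|[|]]]] Hi.
rewrite (cE 0%N) // (cE 1%N) // (cE 2%N) // (cE 3%N) //.
by rewrite /GRing.scale /= mulr1 !mulr0 !addr0.
Qed.

(** A spanning set of group-like elements consists of basis elements. If it missed omega_h, the
    coordinate functional of omega_h would vanish on [C'], although it is nonzero on y eta_g by full
    support. *)
Lemma core_minimal g C' : grouplike_spanned D C' -> y * et g \in C' -> (C <= C')%VS.
Proof.
case=> s [sG ->] ys; have [m [m0 mE]] := full_support_yet g.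
have sV b : b \in s -> b \in glikes iota zeta x y.
  move=> /sG bG; apply: (grouplike_in_basis comulL counitL (X := in_tuple _)) => // b' b'g.
  exact: glikes_grouplike.
apply/span_subvP => b; rewrite -[[:: _; _; _; _]]/([seq om g | g <- [:: g1; g2; g3; g4]]).
case/mapP=> h _ ->; case: (boolP (om h \in s)) => [/memv_span // | hs].
have [F [lF FE]] := dual_functional bB (mem_om h).
have F0 : F (y * et g) = 0.
  apply: (span_linear_ext lF (f' := fun=> 0) _ _ ys) => [k u v | b' b's].
    by rewrite scaler0 addr0.
  rewrite FE ?sV //; case: eqP => // E; by rewrite -E b's in hs.
case/eqP: (m0 h); rewrite -F0 mE (linear_prop_sum lF) (bigD1 h) //= big1 => [|h' h'h].
  by rewrite (linear_propZ lF) FE ?mem_om // eqxx addr0 [RHS]mulr1.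
by rewrite (linear_propZ lF) FE ?mem_om // (inj_eq om_inj) (negPf h'h) [LHS]mulr0.
Qed.

Lemma example_is_core : is_core D y C.
Proof.
split=> [|eta' /appears_in_antip[g ->]]; first exact: appears_in_exists.
split.
- exists [seq om g | g <- [:: g1; g2; g3; g4]]; split=> // b /mapP[h _ ->].
  exact: (glikes_grouplike (mem_om _)).
- have [m [_ ->]] := full_support_yet g.
  by apply: rpred_sum => h _; apply/rpredZ/core_om.
- by move=> C'; apply: core_minimal.
Qed.

End ExampleHopf.

(** * The index group and the final statement *)

Lemma repr_coset_trivial (gT : finGroupType) (N : {set gT}) (g : gT) :
  N = 1%g -> repr (coset N g) = g.
Proof.
move=> ->; have := mem_repr_coset (coset 1%g g).
rewrite val_coset ?norm1 ?inE // => /rcosetP[h].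
by rewrite inE => /eqP-> ->; rewrite mul1g.
Qed.

(** When T_eta is trivial, every coset is a singleton and its representative is the element itself.
    Elements of Q^perp thus act through the index group as before, so that g_2 can be used to refute
    complete triviality there. *)
Lemma core_str_act (K : fieldType) (gT : finGroupType) (A : falgType K)
    (D : ydhopf gT A) (eta : A) (g : gT) :
  Tgrp D eta = [set 1%g] -> g \in Qperp D eta ->
  exists u : index_grp D eta, forall c,
    ydact (core_str D eta) (gelt K u) c = ydact D (gelt K g) c.
Proof.
move=> T1 gQ.
have N1 : Tgrp D eta :&: Qperp D eta = 1%g.
  rewrite T1; apply: (setIidPl (A := [set 1%g]) _); rewrite sub1set.
  exact: (group1 (Qperp_group D eta)).
exists (subg _ (coset (Tgrp D eta :&: Qperp D eta) g)) => c.
rewrite /= (sum_gelt (fun u : index_grp D eta => ydact D (gelt K (repr (sgval u))) c)).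
rewrite subgK; first by rewrite repr_coset_trivial.
by move: N1; move: (_ :&: _) => N ->; apply: (mem_quotient 1%G).
Qed.

Theorem mainTheorem1 (K : closedFieldType) (charK : [pchar K] =i pred0)
    (iota zeta : K) (iotaP : 4.-primitive_root iota) (zetaP : zeta ^+ 4 = 1) :
  (forall t : alg_kind,
    (exists (A : falgType K) (x y : A), presented t zeta x y) /\
    (forall (A : falgType K) (x y : A), presented t zeta x y ->
      (exists D : ydhopf G22 A, example_structure iota zeta x y t D) /\
      (forall D : ydhopf G22 A, example_structure iota zeta x y t D ->
        let w1 := omega1 A in
        let w2 := omega2 iota zeta x in
        let w3 := omega3 iota zeta x in
        let w4 := omega4 x in
        let C := core_span iota zeta x in
        let e g : groupAlg K G22 := gelt K g in
        [/\ \dim {:A} = 8%N,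
            is_ydhopf D, cocommutative D & cosemisimple D] /\
        match t with
        | TypeI => forall a b : A, a * b = b * a
        | TypeII => ~ (forall a b : A, a * b = b * a)
        end /\
        ~ trivial_on D {:A} /\
        [/\ grouplike D (eta1 y), is_core D (eta1 y) C & \dim C = 4%N] /\
        (Tgrp D (eta1 y) = [set 1%g] /\
         forall chi, in_Qgrp D (eta1 y) chi <-> chi =1 (fun=> 1)) /\
        trivial_on D C /\
        ordinary_hopf_on D C /\
        (exists f : groupAlg K G22 -> A,
          [/\ f (e g1) = w1, f (e g2) = w2, f (e g3) = w3 & f (e g4) = w4] /\
          hopf_iso_onto D C f) /\
        ~ completely_trivial_on D C /\
        [/\ ydact D (e g2) w2 = w3, w3 <> w2,
            ydcoact D w2 = (2^-1 *: (e g1 + e g3)) \tens w2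
                         + (2^-1 *: (e g1 - e g3)) \tens w3 &
            ydcoact D w3 = (2^-1 *: (e g1 - e g3)) \tens w2
                         + (2^-1 *: (e g1 + e g3)) \tens w3]))) /\
  (exists (gT : finGroupType) (A : falgType K) (D : ydhopf gT A)
      (eta : A) (C : {vspace A}),
    [/\ abelian [set: gT], is_ydhopf D, cocommutative D & cosemisimple D] /\
    [/\ grouplike D eta, is_core D eta C &
        ~ completely_trivial_on (core_str D eta) C]).
Proof.
have nz2 : (2 : K) != 0 by apply/negP => K2; have := charK 2; rewrite !inE K2.
have iota2 : iota ^+ 2 = -1.
  have i4 := prim_expr_order iotaP.
  have /eqP : (iota ^+ 2 - 1) * (iota ^+ 2 + 1) = 0 by rewrite -subr_sqr -exprM i4 expr1n subrr.
  (* The alternative iota^2 = 1 is excluded because the order 4 of iota does not divide 2. *)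
  rewrite mulf_eq0 subr_eq0 addr_eq0 => /orP[|/eqP //].
  by rewrite -(prim_order_dvd iotaP).
have exK t := @presented_exists K t zeta.
split=> [t | ].
  split=> [|A x y xyP]; first exact: exK.
  split=> [|D exD]; first exact: exists_example.
  move=> w1 w2 w3 w4 C e.
  have [d8 _] := presented_span xyP.
  split; first split => //.
  - exact: (example_is_ydhopf nz2 iota2 zetaP xyP exD).
  - exact: (example_cocommutative nz2 iota2 zetaP xyP exD).
  - exact: (example_cosemisimple nz2 iota2 zetaP xyP exD).
  split.
    case: t xyP {exD} => xyP; first exact: (example_commutative xyP).
    exact: (example_noncommutative nz2 iota2 zetaP xyP).
  split; first exact: (example_nontrivial nz2 iota2 zetaP xyP exD).
  split; first split.
  - apply: (glikes_grouplike nz2 iota2 zetaP xyP exD).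
    exact: (mem_et iota zeta x y g1).
  - exact: (example_is_core nz2 iota2 zetaP xyP exD).
  - exact: (dim_core nz2 iota2 zetaP xyP).
  split; first split.
  - exact: (Tgrp_y nz2 iota2 zetaP xyP exD).
  - exact: (Qgrp_y nz2 iota2 zetaP xyP exD).
  split; first exact: (core_trivial nz2 iota2 zetaP xyP exD).
  split; first exact: (core_ordinary nz2 iota2 zetaP xyP exD).
  split.
    exists (core_iso iota zeta x); split; last exact: (core_iso_onto nz2 iota2 zetaP xyP exD).
    split; [exact: (core_iso_gelt iota zeta x g1) | exact: (core_iso_gelt iota zeta x g2)
      | exact: (core_iso_gelt iota zeta x g3) | exact: (core_iso_gelt iota zeta x g4)].
  split; first exact: (core_not_completely_trivial nz2 iota2 zetaP xyP exD).
  split.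
  - exact: (act_om2 xyP exD).
  - exact: (om3_neq_om2 nz2 iota2 zetaP xyP).
  - exact: (coact_om2 nz2 iota2 zetaP xyP exD).
  - exact: (coact_om3 nz2 iota2 zetaP xyP exD).
have [A [x [y xyP]]] := exK TypeI.
have [D exD] := exists_example nz2 iota2 zetaP xyP.
exists G22, A, D, y, (core_span iota zeta x); split; split.
- by apply/centsP => g _ h _; apply: bich_abelian (theta_bicharacter nz2 zetaP) _ _.
- exact: (example_is_ydhopf nz2 iota2 zetaP xyP exD).
- exact: (example_cocommutative nz2 iota2 zetaP xyP exD).
- exact: (example_cosemisimple nz2 iota2 zetaP xyP exD).
- apply: (glikes_grouplike nz2 iota2 zetaP xyP exD).
  exact: (mem_et iota zeta x y g1).
- exact: (example_is_core nz2 iota2 zetaP xyP exD).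
have T1 := Tgrp_y nz2 iota2 zetaP xyP exD.
(* Only the trivial character lies in Q_y, so the condition defining Q_y^perp is empty of content at
   g_2. *)
have Q1 : g2 \in Qperp D y.
  by rewrite inE; apply/asboolP => chi /(Qgrp_y nz2 iota2 zetaP xyP exD) ->.
have [u uE] := core_str_act T1 Q1.
case=> /(_ (gelt K u) _ (core_om iota zeta x g2)) + _.
rewrite uE (act_om2 xyP exD) KGcounit_gelt scale1r.
exact: (om3_neq_om2 nz2 iota2 zetaP xyP).
Qed.
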